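(* Let $\alpha$ be a composition and let $n\ge 1$. The operator $\omega$ maps quasisymmetric Schur functions to row-strict quasisymmetric Schur functions with the order of the variables reversed; that is, $$\omega(\mathcal{S}_{\alpha})(x_1,\ldots,x_n)=\mathcal{RS}_{\alpha}(x_n,\ldots,x_1).$$
   Context: A composition $\alpha=(\alpha_1,\ldots,\alpha_l)$ of $N$ is a finite sequence of positive integers summing to $N$. Its diagram has $l$ rows of left-justified cells, the $i$-th row from the top having $\alpha_i$ cells. Let $m$ be the largest part of $\alpha$. For a filling $F$ of the diagram with positive integers, $\hat F$ is the $l\times m$ array obtained by adding cells with entry $0$ to the end of each row; $\hat F(i,j)$ is the entry in row $i$, column $j$; and $x^F=\prod_i x_i^{w_i(F)}$, where $w_i(F)$ is the number of occurrences of $i$ in $F$. A column-strict composition tableau (CSCT) of shape $\alpha$ is a filling $F$ such that (1) entries weakly decrease in each row from left to right; (2) entries in the leftmost column strictly increase from top to bottom; (3) for $1\le i<j\le l$, $2\le k\le m$: if $\hat F(j,k)\neq 0$ and $\hat F(j,k)\ge \hat F(i,k)$ then $\hat F(j,k)>\hat F(i,k-1)$. The quasisymmetric Schur function is $\mathcal{S}_\alpha=\sum_F x^F$ over all CSCTs $F$ of shape $\alpha$. A row-strict composition tableau (RSCT) of shape $\alpha$ is a filling $F$ such that (1) entries strictly decrease in each row from left to right; (2) entries in the leftmost column weakly increase from top to bottom; (3) for $1\le i<j\le l$, $2\le k\le m$: if $\hat F(j,k)>\hat F(i,k)$ then $\hat F(j,k)\ge \hat F(i,k-1)$. The row-strict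 quasisymmetric Schur function is $\mathcal{RS}_\alpha=\sum_F x^F$ over all RSCTs $F$ of shape $\alpha$. For a function $f$ in $x_1,x_2,\ldots$, $f(x_1,\ldots,x_n)$ denotes the polynomial obtained by setting $x_i=0$ for $i>n$, and $f(x_n,\ldots,x_1)$ is the result of substituting $x_i\mapsto x_{n+1-i}$ in that polynomial. $M_\alpha=\sum_{i_1<\cdots<i_l}x_{i_1}^{\alpha_1}\cdots x_{i_l}^{\alpha_l}$ is the monomial quasisymmetric function and $F_\alpha=\sum_{\beta\preceq\alpha}M_\beta$ is Gessel's fundamental quasisymmetric function, where $\beta\preceq\alpha$ means $\alpha$ is obtained from $\beta$ by summing some adjacent parts (i.e. $\beta$ refines $\alpha$). The $F_\alpha$ form a basis of the space of quasisymmetric functions $Qsym$. Compositions $\alpha=(\alpha_1,\ldots,\alpha_l)$ of $N$ correspond bijectively to subsets $\{\alpha_1,\alpha_1+\alpha_2,\ldots,\alpha_1+\cdots+\alpha_{l-1}\}$ of $[N-1]=\{1,\ldots,N-1\}$; the complement $\tilde\alpha$ is the composition of $N$ corresponding to the complementary subset of $[N-1]$, and $rev(\beta)$ is $\beta$ with its parts in reverse order. The linear operator $\omega:Qsym\to Qsym$ is defined by $\omega(F_\alpha)=F_{rev(\tilde\alpha)}$. *)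

(* Defs.v *)
From HB Require Import structures.
From mathcomp Require Import all_boot all_order all_algebra finmap.
From mathcomp Require Import mathcomp_extra boolp classical_sets functions.
From mathcomp Require Import cardinality fsbigop.
From mathcomp Require Import mpoly.
From mathcomp Require Import zify.

Set Implicit Arguments.
Unset Strict Implicit.
Unset Printing Implicit Defensive.

Import GRing.Theory.
Local Open Scope ring_scope.

Record composition := Composition { parts :> seq nat;
                                    parts_gt0 : all (leq 1) parts }.
HB.instance Definition _ := [isSub for parts].
HB.instance Definition _ := [Countable of composition by <:].

(* The blocks of ss are the runs of adjacent parts of b that are summed; they
   are nonempty since the parts of a are positive. *)
Definition refines (b a : composition) : Prop :=
  exists2 ss : seq (seq nat), flatten ss = b & map sumn ss = a.

Fact rev_comp_gt0 (a : composition) : all (leq 1) (rev a).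
Proof. by rewrite all_rev parts_gt0. Qed.
Definition rev_comp (a : composition) := Composition (rev_comp_gt0 a).

(* The subset {a_1, a_1 + a_2, ..., a_1 + ... + a_(l-1)} of {1, ..., N-1}. *)
Definition comp_set (a : composition) : seq nat :=
  [seq sumn (take i a) | i <- iota 1 (size a).-1].

(* The composition of N given by the consecutive differences of the elements
   of {0} U (D inter {1, ..., N-1}) U {N}; it is empty when N = 0. *)
Definition set_comp_seq (N : nat) (D : pred nat) : seq nat :=
  pairmap (fun i j => j - i)%N 0%N [seq i <- iota 1 N | (i == N) || D i].

Lemma path_set_comp N (D : pred nat) :
  path ltn 0 [seq i <- iota 1 N | (i == N) || D i].
Proof.
rewrite path_min_sorted.
  by apply: sorted_filter; [exact: ltn_trans|exact: iota_ltn_sorted].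
by apply/allP => i; rewrite mem_filter mem_iota => /and3P[].
Qed.

Fact set_comp_gt0 N D : all (leq 1) (set_comp_seq N D).
Proof.
rewrite /set_comp_seq; move: (path_set_comp N D); move: (filter _ _) => s.
have H t x : path ltn x t -> all (leq 1) (pairmap (fun i j => j - i)%N x t).
  by elim: t x => //= i t IH j /andP[lt_ji /IH ->]; rewrite subn_gt0 lt_ji.
exact: H.
Qed.
Definition set_comp N D := Composition (set_comp_gt0 N D).

Definition compl_comp (a : composition) : composition :=
  set_comp (sumn a) (fun i => i \notin comp_set a).

Lemma last_set_comp N (D : pred nat) :
  last 0%N [seq i <- iota 1 N | (i == N) || D i] = N.
Proof.
case: N => // N; rewrite -addn1 iotaD filter_cat last_cat /=.
by rewrite addnC eqxx.
Qed.

Lemma psum_pairmap s (x : nat) k : path ltn x s -> (k <= size s)%N ->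
  (x + sumn (take k (pairmap (fun i j => j - i)%N x s)) = nth 0%N (x :: s) k)%N.
Proof.
elim: s x k => [|y s IH] x [|k] //=; rewrite ?addn0 //.
by move=> /andP[xy ps] ks; have := IH y k ps ks; rewrite /=; lia.
Qed.

Lemma sumn_set_comp N D : sumn (set_comp N D) = N.
Proof.
rewrite -[RHS](last_set_comp N D) /= /set_comp_seq.
set s := filter _ _; have := @psum_pairmap s 0 (size s) (path_set_comp _ _).
by rewrite take_oversize ?size_pairmap // add0n (nth_last 0%N (0%N :: s)) => ->.
Qed.

Lemma mem_comp_set N (D : pred nat) i :
  (i \in comp_set (set_comp N D)) = [&& 0 < i, i < N & D i]%N.
Proof.
rewrite /comp_set /= /set_comp_seq size_pairmap.
set s := filter _ _; have ps : path ltn 0 s := path_set_comp _ _.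
have lasts : last 0%N s = N := last_set_comp N D.
have -> : [seq sumn (take j (pairmap (fun x y => y - x)%N 0%N s))
            | j <- iota 1 (size s).-1] = take (size s).-1 s.
  apply: (@eq_from_nth _ 0%N) => [|j].
    by rewrite size_map size_iota size_take; case: s {ps lasts} => //= ? ? ; rewrite ltnSn.
  rewrite size_map size_iota => js; rewrite (nth_map 0%N) ?size_iota //.
  rewrite nth_iota // nth_take // -[LHS]add0n psum_pairmap //.
  by apply: leq_trans (leq_pred _); rewrite add1n.
have [N0|N0] := posnP N.
  have -> : s = [::] by rewrite /s N0.
  by rewrite N0 /= andbC.
have sE : s = rcons (take (size s).-1 s) N.
  have : (0 < size s)%N.
    by case: (s) lasts N0 => //= <-.
  case/lastP: (s) lasts => // t x; rewrite last_rcons size_rcons /= => -> _.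
  by rewrite -cats1 take_size_cat // cats1.
have us : uniq s by rewrite filter_uniq ?iota_uniq.
have : (i \in s) = [&& 0 < i, i < N.+1 & (i == N) || D i]%N.
  by rewrite mem_filter mem_iota add1n andbC andbA.
rewrite {1}sE mem_rcons inE; have [->|iN] := eqVneq i N => /=.
  move=> _; rewrite ltnn andbF; move: us; rewrite {1}sE rcons_uniq.
  by case/andP=> /negPf.
by move=> ->; rewrite ltnS [(i <= N)%N]leq_eqVlt (negPf iN).
Qed.

Lemma comp_set_inj (a b : composition) :
  sumn a = sumn b -> comp_set a =i comp_set b -> a = b.
Proof.
move=> ab abi; apply: val_inj => /=.
have srt (c : composition) : sorted ltn (comp_set c).
  apply/(sortedP 0%N) => i; rewrite size_map size_iota => lti.
  rewrite !(nth_map 0%N) ?size_iota ?(ltnW lti) // !nth_iota ?(ltnW lti) //.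
  have cs : (1 + i < size c)%N by lia.
  rewrite [X in is_true X]/= addnS (take_nth 0%N) // sumn_rcons.
  rewrite -[X in (X < _)%N]addn0 ltn_add2l.
  by have /(all_nthP 0%N) := parts_gt0 c; apply.
have {srt abi} eqs : comp_set a = comp_set b.
  by apply: (irr_sorted_eq ltn_trans ltnn) => //; apply: srt.
have sz : size a = size b.
  have : (size a).-1 = (size b).-1.
    by have := congr1 size eqs; rewrite !size_map !size_iota.
  have /= := parts_gt0 a; have /= := parts_gt0 b.
  by move: ab; case: (parts a) (parts b) => [|x s] [|y t] //=; lia.
have psum i : sumn (take i a) = sumn (take i b).
  have [|] := leqP (size a) i.
    by move=> la; rewrite !take_oversize ?ab // -sz.
  case: i => [|i] ia; first by rewrite !take0.
  have := congr1 (nth 0%N ^~ i) eqs.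
  have ia' : (i < (size a).-1)%N by move: ia; case: (size a).
  by rewrite !(nth_map 0%N) ?size_iota -?sz // !nth_iota -?sz // add1n.
apply: (@eq_from_nth _ 0%N) => // i ia.
have := psum i.+1; rewrite !(take_nth 0%N) -?sz // !sumn_rcons psum.
by move/addnI.
Qed.

Lemma set_compK (a : composition) : set_comp (sumn a) (mem (comp_set a)) = a.
Proof.
apply: comp_set_inj; rewrite ?sumn_set_comp // => i.
rewrite mem_comp_set; apply/and3P/idP => [[]//|ia]; split=> //.
- case/mapP: ia => j; rewrite mem_iota => /andP[j1 js] ->.
  have := parts_gt0 a; case: (parts a) js j1 => [|x s] //=.
    by case: j.
  by case: j => //= j _ _ /andP[+ _]; lia.
- case/mapP: ia => j; rewrite mem_iota => /andP[j1 js] ->.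
  have ja : (j < size a)%N by move: js j1; case: (size a) => [|k]; lia.
  rewrite -[X in (_ < sumn X)%N](cat_take_drop j a) sumn_cat.
  rewrite -[X in (X < _)%N]addn0 ltn_add2l (drop_nth 0%N) //=.
  have /(all_nthP 0%N)/(_ _ ja) := parts_gt0 a; lia.
Qed.

(* The exponent vector [e] stands for the monomial prod_i x_(i+1) ^ (e i):
   variables are indexed from 0 here, so that x_1, ..., x_n are those with
   index in 'I_n. *)
Definition expo := {fsfun nat -> nat with 0%N}.

Definition edeg (e : expo) : nat := (\sum_(i <- finsupp e) e i)%N.

(* Formal power series in countably many variables, by coefficients. *)
Definition series (R : comNzRingType) := expo -> R^o.

Section Series.
Variable R : comNzRingType.
HB.instance Definition _ := GRing.Lmodule.on (series R).
End Series.

(* The monomial prod_j x_(s_j + 1) ^ (a_j), for s without repetition. *)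
Definition xpow (s a : seq nat) : expo :=
  [fsfun k in [fset k in s]%fset => nth 0%N a (index k s) | 0%N].

(* The formal sum of the monomials w t for t in D, coefficient by coefficient;
   a sum over \in is 0 when it has infinitely many nonzero terms. *)
Definition monomial_sum (R : comNzRingType) (T : choiceType) (D : set T)
    (w : T -> expo) : series R :=
  fun e => \sum_(t \in D) ((w t == e)%:R : R).

Definition is_qsym (R : comNzRingType) (f : series R) : Prop :=
  (exists d, forall e, (d < edeg e)%N -> f e = 0) /\
  (forall (a : composition) (s t : seq nat),
     sorted ltn s -> sorted ltn t -> size s = size a -> size t = size a ->
     f (xpow s a) = f (xpow t a)).

Definition qsym_pred (R : comNzRingType) : {pred series R} :=
  fun f => `[< is_qsym f >].

Lemma qsym_submod (R : comNzRingType) : submod_closed (@qsym_pred R).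
Proof.
split=> [|c f g].
  by apply/asboolP; split=> [|a s t *]; [exists 0%N|].
move=> /asboolP[[d fd] fs] /asboolP[[d' gd] gs]; apply/asboolP; split.
  exists (maxn d d') => e; rewrite gtn_max => /andP[/fd fe /gd ge].
  by rewrite /= !fctE fe ge scaler0 addr0.
by move=> a s t *; rewrite /= !fctE (fs a s t) // (gs a s t).
Qed.
HB.instance Definition _ (R : comNzRingType) :=
  GRing.isSubmodClosed.Build R (series R) (@qsym_pred R) (@qsym_submod R).

Record qsym (R : comNzRingType) :=
  QSym { qsym_val : series R; _ : qsym_val \in @qsym_pred R }.
HB.instance Definition _ (R : comNzRingType) := [isSub for @qsym_val R].
HB.instance Definition _ (R : comNzRingType) := [Choice of qsym R by <:].
HB.instance Definition _ (R : comNzRingType) :=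
  [SubChoice_isSubLmodule of qsym R by <:].

Lemma qsymP (R : comNzRingType) (f : qsym R) : is_qsym (qsym_val f).
Proof. by apply/asboolP; case: f. Qed.

Definition coef (R : comNzRingType) (f : qsym R) (e : expo) : R := qsym_val f e.

Definition to_qsym (R : comNzRingType) (f : series R) (H : is_qsym f) : qsym R :=
  QSym (introT (asboolP _) H).

Lemma xpowE s a k : size s = size a -> xpow s a k = nth 0%N a (index k s).
Proof.
move=> sa; rewrite fsfunE !inE; case: ifP => // /negbT ks.
by rewrite nth_default // memNindex // sa.
Qed.

Lemma xpow_nth s a i : uniq s -> size s = size a -> (i < size s)%N ->
  xpow s a (nth 0%N s i) = nth 0%N a i.
Proof. by move=> us sa li; rewrite xpowE // index_uniq. Qed.

Lemma xpow_supp s (a : composition) k : size s = size a ->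
  (xpow s a k != 0%N) = (k \in s).
Proof.
move=> sa; rewrite xpowE //; have [ks|ks] := boolP (k \in s).
  rewrite -lt0n; have /(all_nthP 0%N) := parts_gt0 a; apply.
  by rewrite -sa index_mem.
by rewrite nth_default // memNindex // sa.
Qed.

Lemma sorted_ltn_uniq s : sorted ltn s -> uniq s.
Proof. by apply: sorted_uniq => //; [exact: ltn_trans|exact: ltnn]. Qed.

Lemma xpow_inj s t (a b : composition) :
  sorted ltn s -> sorted ltn t -> size s = size a -> size t = size b ->
  xpow s a = xpow t b -> s = t /\ a = b.
Proof.
move=> ss st sa tb eab.
have st' : s = t.
  apply: (irr_sorted_eq ltn_trans ltnn) => // k.
  by rewrite -(xpow_supp _ sa) eab xpow_supp.
split=> //; apply: val_inj; apply: (@eq_from_nth _ 0%N) => [/=|i ia].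
  by rewrite -sa -tb st'.
have us := sorted_ltn_uniq ss.
rewrite /= -(xpow_nth us sa) ?sa // eab st' xpow_nth -?st' //; last by rewrite sa.
by rewrite st'.
Qed.

Lemma edegE (e : expo) s : uniq s -> (forall k, e k != 0%N -> k \in s) ->
  edeg e = (\sum_(k <- s) e k)%N.
Proof.
move=> us H; rewrite /edeg [RHS](bigID (fun k => e k != 0%N)) /=.
rewrite [X in (_ + X)%N]big1 ?addn0; last by move=> k /negPn/eqP.
rewrite -[RHS]big_filter; apply: perm_big; apply: uniq_perm; rewrite ?filter_uniq ?fset_uniq //.
by move=> k; rewrite mem_finsupp mem_filter; case: (eqVneq (e k) 0%N) => // /H ->.
Qed.

Lemma edeg_xpow s (a : composition) : uniq s -> size s = size a ->
  edeg (xpow s a) = sumn a.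
Proof.
move=> us sa; rewrite (@edegE _ s) // => [|k]; last by rewrite xpow_supp.
rewrite (big_nth 0%N) sumnE [RHS](big_nth 0%N) sa !big_nat.
by apply: eq_bigr => i ia; rewrite xpow_nth // sa.
Qed.

Lemma monomial_sum_neq0 (R : comNzRingType) (T : choiceType) (D : set T) w e :
  @monomial_sum R T D w e != 0 -> exists2 t, D t & w t = e.
Proof.
move=> /eqP H; apply: contrapT => H'; apply: H; apply: fsbig1 => t Dt.
by case: eqP => // wt; case: H'; exists t.
Qed.

Lemma monomial_sum_fibre (R : comNzRingType) (T : choiceType) (D : set T) w e :
  @monomial_sum R T D w e = \sum_(t \in D `&` w @^-1` [set e]) (1 : R).
Proof.
rewrite fsbig_mkcondr; apply: eq_fsbigr => t _.
by case: ifPn; rewrite (inE, notin_setE) /= => H; case: eqP.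
Qed.

Definition monomial_series (R : comNzRingType) (a : composition) : series R :=
  monomial_sum R [set s | sorted ltn s /\ size s = size a] (xpow^~ a).

Lemma monomial_seriesE (R : comNzRingType) (a b : composition) t :
  sorted ltn t -> size t = size b ->
  monomial_series R a (xpow t b) = (a == b)%:R.
Proof.
move=> st tb; have [ab|ab] := eqVneq a b; last first.
  apply: fsbig1 => s [ss sa]; case: eqP => // /xpow_inj[] // _ /eqP.
  by rewrite (negPf ab).
subst b; rewrite -[LHS](fsbig_widen [set t]) ?fsbig_set1 ?eqxx //.
  by move=> _ ->; split.
move=> s [[ss sa] sNt]; rewrite /preimage /=; case: eqP => // /xpow_inj[] //.
Qed.

Lemma edeg_M (R : comNzRingType) (a : composition) e :
  monomial_series R a e != 0 -> edeg e = sumn a.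
Proof.
case/monomial_sum_neq0 => s [ss sa] <-.
by rewrite edeg_xpow ?sorted_ltn_uniq.
Qed.

Lemma M_is_qsym (R : comNzRingType) (a : composition) : is_qsym (monomial_series R a).
Proof.
split=> [|b s t ss st sb tb]; last by rewrite !monomial_seriesE.
by exists (sumn a) => e; apply: contraTeq => /edeg_M->; rewrite ltnn.
Qed.
Definition monomial_qsym R a : qsym R := to_qsym (M_is_qsym R a).

Definition fundamental_qsym R a : qsym R := \sum_(b \in [set b | refines b a]) monomial_qsym R b.

(* A filling is given by its list of rows, from top to bottom. *)
Definition filling (a : composition) (T : seq (seq nat)) : Prop :=
  map size T = a /\ all (all (leq 1)) T.

Definition largest_part (a : composition) : nat := \max_(p <- a) p.

(* The entry of the array \hat T in row i+1 and column j+1, which is 0 outside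
   the diagram. *)
Definition entry (T : seq (seq nat)) (i j : nat) : nat :=
  nth 0%N (nth [::] T i) j.

(* The exponent vector of x^T: the variable of index k is x_(k+1). *)
Definition weight (T : seq (seq nat)) : expo :=
  [fsfun k in [fset i.-1 | i in flatten T]%fset =>
     count_mem k.+1 (flatten T) | 0%N].

(* Rows and columns are numbered from 0, so that k.+1 runs over the columns
   2, ..., m of the usual numbering. *)
Definition CSCT (a : composition) (T : seq (seq nat)) : Prop :=
  [/\ filling a T,
      all (sorted geq) T,
      sorted ltn [seq entry T i 0 | i <- iota 0 (size a)] &
      forall i j k, (i < j < size a)%N -> (k.+1 < largest_part a)%N ->
        entry T j k.+1 != 0%N -> (entry T i k.+1 <= entry T j k.+1)%N ->
        (entry T i k < entry T j k.+1)%N].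

Definition RSCT (a : composition) (T : seq (seq nat)) : Prop :=
  [/\ filling a T,
      all (sorted gtn) T,
      sorted leq [seq entry T i 0 | i <- iota 0 (size a)] &
      forall i j k, (i < j < size a)%N -> (k.+1 < largest_part a)%N ->
        (entry T i k.+1 < entry T j k.+1)%N ->
        (entry T i k <= entry T j k.+1)%N].

Definition relabel (s t : seq nat) (e : nat) : nat :=
  if e is k.+1 then (nth 0%N t (index k s)).+1 else 0%N.

Lemma relabel_mono s t : sorted ltn s -> sorted ltn t -> size s = size t ->
  {in [pred e | (e == 0%N) || (e.-1 \in s)] &,
     {mono relabel s t : x y / (x <= y)%N}}.
Proof.
move=> ss st sz [|x] [|y] //=; rewrite !inE /= => xs ys.
rewrite ltnS -[in RHS](nth_index 0%N xs) -[in RHS](nth_index 0%N ys).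
rewrite ltnS.
have m u : sorted ltn u -> {in gtn (size u) &, {mono nth 0%N u : i j / (i <= j)%N}}.
  by move=> su; apply: leq_mono_in; apply: sorted_ltn_nth => //; exact: ltn_trans.
by rewrite !m // ?inE -?sz ?index_mem.
Qed.

Lemma relabelK s t : sorted ltn s -> sorted ltn t -> size s = size t ->
  {in [pred e | (e == 0%N) || (e.-1 \in s)], cancel (relabel s t) (relabel t s)}.
Proof.
move=> ss st sz [|x] //=; rewrite !inE /= => xs.
by rewrite index_uniq ?sorted_ltn_uniq -?sz ?index_mem // nth_index.
Qed.

Lemma relabel_mem s t e : size s = size t ->
  (e == 0%N) || (e.-1 \in s) ->
  (relabel s t e == 0%N) || ((relabel s t e).-1 \in t).
Proof. by case: e => //= k sz ks; rewrite mem_nth // -sz index_mem. Qed.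

Lemma weightE T k : all (all (leq 1)) T ->
  weight T k = count_mem k.+1 (flatten T).
Proof.
move=> /allP T0; rewrite fsfunE; case: ifP => // /negbT kT.
apply/esym/count_memPn; apply: contra kT => kT.
by apply/imfsetP; exists k.+1.
Qed.

Lemma entry_map (g : nat -> nat) T i j : g 0%N = 0%N ->
  entry (map (map g) T) i j = g (entry T i j).
Proof.
move=> g0; rewrite /entry; have [iT|iT] := ltnP i (size T).
  rewrite (nth_map [::]) //; have [jT|jT] := ltnP j (size (nth [::] T i)).
    by rewrite (nth_map 0%N).
  by rewrite nth_default ?size_map // nth_default.
by rewrite !(@nth_default _ [::]) ?size_map // !nth_nil.
Qed.

Lemma entry_mem T i j : entry T i j \in 0%N :: flatten T.
Proof.
rewrite /entry inE; have [iT|iT] := ltnP i (size T); last first.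
  by rewrite (@nth_default _ [::]) // nth_nil.
have [jT|jT] := ltnP j (size (nth [::] T i)); last by rewrite nth_default.
by apply/orP; right; apply/flattenP; exists (nth [::] T i); rewrite mem_nth.
Qed.

Definition relabel_invariant (D : set (seq (seq nat))) : Prop :=
  forall (T : seq (seq nat)) (g : nat -> nat), g 0%N = 0%N ->
    {in 0%N :: flatten T &, {mono g : x y / (x <= y)%N}} -> D T ->
    D (map (map g) T).

Section RelabelInvariant.
Variables (T : seq (seq nat)) (g : nat -> nat) (a : composition).
Hypotheses (g0 : g 0%N = 0%N)
  (gm : {in 0%N :: flatten T &, {mono g : x y / (x <= y)%N}}).

Let glt : {in 0%N :: flatten T &, {mono g : x y / (x < y)%N}}.
Proof. by move=> x y xT yT; rewrite !ltnNge gm. Qed.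

Lemma filling_relabel : filling a T -> filling a (map (map g) T).
Proof.
move=> [sz T0]; split; first by rewrite -map_comp -sz; apply: eq_map => r /=; rewrite size_map.
rewrite all_map; apply/allP => r rT /=; rewrite all_map; apply/allP => x xr /=.
rewrite -g0 glt ?inE ?eqxx //; last first.
  by apply/orP; right; apply/flattenP; exists r.
by have /allP/(_ _ xr) := allP T0 _ rT.
Qed.

Lemma rows_relabel (e : rel nat) :
  {in 0%N :: flatten T &, {mono g : x y / e x y}} ->
  all (sorted e) T -> all (sorted e) (map (map g) T).
Proof.
move=> em /allP H; rewrite all_map; apply/allP => r rT /=; rewrite sorted_map.
apply: (@sub_in_sorted _ (mem r) e); [|exact/allP|exact: H].
move=> x y xr yr /=; rewrite em //.
  by rewrite inE; apply/orP; right; apply/flattenP; exists r.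
by rewrite inE; apply/orP; right; apply/flattenP; exists r.
Qed.

Lemma col_relabel (e : rel nat) n :
  {in 0%N :: flatten T &, {mono g : x y / e x y}} ->
  sorted e [seq entry T i 0 | i <- iota 0 n] ->
  sorted e [seq entry (map (map g) T) i 0 | i <- iota 0 n].
Proof.
move=> em; rewrite !sorted_map; apply: sub_sorted => i j /=.
by rewrite !entry_map // em ?entry_mem.
Qed.

Lemma CSCT_relabel : CSCT a T -> CSCT a (map (map g) T).
Proof.
case=> f r c t; split.
- exact: filling_relabel.
- by apply: rows_relabel r => x y xT yT; rewrite /= gm.
- by apply: col_relabel c => x y xT yT; rewrite /= glt.
- move=> i j k ij km; rewrite !entry_map // gm ?entry_mem // glt ?entry_mem // => n0.
  by apply: t => //; apply: contraNneq n0 => ->; rewrite g0.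
Qed.

Lemma RSCT_relabel : RSCT a T -> RSCT a (map (map g) T).
Proof.
case=> f r c t; split.
- exact: filling_relabel.
- by apply: rows_relabel r => x y xT yT; rewrite /= glt.
- by apply: col_relabel c => x y xT yT; rewrite /= gm.
- by move=> i j k ij km; rewrite !entry_map // gm ?entry_mem // glt ?entry_mem //; apply: t.
Qed.

End RelabelInvariant.

Lemma filling_gt0 a T x : filling a T -> x \in flatten T -> (0 < x)%N.
Proof.
by move=> [_ /allP T0] /flattenP[r rT xr]; have /allP/(_ _ xr) := T0 _ rT.
Qed.

Lemma edeg_weight a T : filling a T -> edeg (weight T) = sumn a.
Proof.
move=> fT; have [sz T0] := fT.
rewrite (@edegE _ (undup (map predn (flatten T)))) ?undup_uniq //; last first.
  move=> k; rewrite weightE // -lt0n -has_count => /hasP[x xT /eqP xk].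
  by rewrite mem_undup; apply/mapP; exists x => //; rewrite xk.
under eq_bigr => k _ do rewrite weightE // -sum1_count big_mkcond.
rewrite exchange_big /= -sz -[map size T]/(shape T) -size_flatten -sum1_size.
apply: eq_big_seq => x xT; have x0 := filling_gt0 fT xT.
rewrite (bigD1_seq x.-1) ?undup_uniq ?mem_undup ?map_f //=.
rewrite prednK // eqxx big1 // => k kx; case: eqP => // xk.
by rewrite xk eqxx in kx.
Qed.

Section WeightRelabel.
Variables (a b : composition) (s t : seq nat) (T : seq (seq nat)).
Hypotheses (ss : sorted ltn s) (st : sorted ltn t).
Hypotheses (sb : size s = size b) (tb : size t = size b).
Hypotheses (fT : filling a T) (wT : weight T = xpow s b).

Lemma relabel_entries x :
  x \in 0%N :: flatten T -> (x == 0%N) || (x.-1 \in s).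
Proof.
rewrite inE => /orP[-> //|xT]; have x0 := filling_gt0 fT xT.
rewrite -(xpow_supp _ sb) -wT weightE ?(fT.2) // prednK // -lt0n -has_count.
by apply/orP; right; rewrite has_pred1.
Qed.

Lemma relabel_mono_entries :
  {in 0%N :: flatten T &, {mono relabel s t : x y / (x <= y)%N}}.
Proof.
move=> x y /relabel_entries xs /relabel_entries ys.
by apply: relabel_mono; rewrite ?sb.
Qed.

Lemma relabel_tabK : map (map (relabel t s)) (map (map (relabel s t)) T) = T.
Proof.
rewrite -map_comp -[RHS]map_id; apply/eq_in_map => r rT /=.
rewrite -map_comp -[RHS]map_id; apply/eq_in_map => x xr /=.
apply: relabelK; rewrite ?sb ?tb //; apply: relabel_entries.
by rewrite inE; apply/orP; right; apply/flattenP; exists r.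
Qed.

Lemma weight_relabel : weight (map (map (relabel s t)) T) = xpow t b.
Proof.
apply/fsfunP => k; rewrite weightE; last first.
  exact: (filling_relabel _ relabel_mono_entries fT).2.
rewrite -map_flatten count_map xpowE //.
have [kt|kt] := boolP (k \in t); last first.
  rewrite nth_default ?memNindex ?tb //; apply/eqP; rewrite -leqn0 leqNgt.
  rewrite -has_count; apply: contra kt => /hasP[x xT] /= /eqP xk.
  have := @relabel_mem s t x; rewrite sb tb xk /=; apply=> //.
  by apply: relabel_entries; rewrite inE xT orbT.
have ks : nth 0%N s (index k t) \in s by rewrite mem_nth // sb -tb index_mem.
have := weightE (nth 0%N s (index k t)) fT.2; rewrite wT xpow_nth ?sb //.
- move=> ->; apply: eq_in_count => x xT /=.
  have xs : x.-1 \in s.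
    have := relabel_entries (x := x); rewrite inE xT orbT => /(_ isT).
    by have := filling_gt0 fT xT; case: x {xT}.
  have := filling_gt0 fT xT; case: x xs {xT} => //= x xs _.
  have ixs : (index x s < size s)%N by rewrite index_mem.
  have ts : size t = size s by rewrite sb.
  have ikt : (index k t < size s)%N by rewrite -ts index_mem.
  rewrite !eqSS -{1}(nth_index 0%N kt) nth_uniq ?sorted_ltn_uniq ?ts //.
  by rewrite -[in RHS](nth_index 0%N xs) nth_uniq ?sorted_ltn_uniq.
- exact: sorted_ltn_uniq.
- by rewrite -tb index_mem.
Qed.

End WeightRelabel.

Lemma tableau_sum_is_qsym (R : comNzRingType) (a : composition)
    (D : set (seq (seq nat))) :
  (forall T, D T -> filling a T) -> relabel_invariant D ->
  is_qsym (monomial_sum R D weight).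
Proof.
move=> Da Dr; split.
  exists (sumn a) => e; apply: contraTeq => /monomial_sum_neq0[T DT <-].
  by rewrite (edeg_weight (Da _ DT)) ltnn.
move=> b s t ss st sb tb; rewrite !monomial_sum_fibre.
apply: (reindex_fsbig (map (map (relabel t s)))); split.
- move=> T [DT wT]; have fT := Da _ DT; split.
    by apply: Dr => //; apply: (relabel_mono_entries (b := b) (a := a)).
  exact: (weight_relabel (a := a)).
- move=> T T' /set_mem[DT wT] /set_mem[DT' wT'] /(congr1 (map (map (relabel s t)))).
  rewrite !(@relabel_tabK a b) //; exact: Da.
- move=> T [DT wT]; have fT := Da _ DT; exists (map (map (relabel s t)) T).
    split; last exact: (weight_relabel (a := a)).
    by apply: Dr => //; apply: (relabel_mono_entries (b := b) (a := a)).
  by rewrite (@relabel_tabK a b).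
Qed.

(* The coefficients of the tableau sums below do count tableaux: only finitely
   many of them have a given weight. *)
Lemma finite_filling (a : composition) e :
  finite_set [set T | filling a T /\ weight T = e].
Proof.
pose m := (\max_(k <- finsupp e) k).+2.
pose f (w : (sumn a).-tuple 'I_m) := reshape a (map val w).
apply: (@sub_finite_set _ _ [set f w | w in [set: (sumn a).-tuple 'I_m]]).
  move=> T [fT wT]; have [sz T0] := fT.
  have szT : size (map (fun x => inord x : 'I_m) (flatten T)) == sumn a.
    by rewrite size_map size_flatten /shape sz.
  exists (Tuple szT) => //; rewrite /f /= -map_comp -sz -[RHS]flattenK.
  congr reshape; rewrite -[RHS]map_id; apply/eq_in_map => x xT /=.
  have x0 := filling_gt0 fT xT.
  rewrite inordK // ltnS -(prednK x0) ltnS.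
  have : x.-1 \in finsupp e.
    by rewrite mem_finsupp -wT weightE // prednK // -lt0n -has_count has_pred1.
  by move=> xe; rewrite (big_rem x.-1) //= leq_maxl.
by apply: finite_image; exact: finite_finset.
Qed.

Lemma S_is_qsym (R : comNzRingType) (a : composition) :
  is_qsym (monomial_sum R [set T | CSCT a T] weight).
Proof.
apply: (@tableau_sum_is_qsym _ a) => [T []//|T g g0 gm].
exact: CSCT_relabel.
Qed.
Definition qschur R a : qsym R := to_qsym (S_is_qsym R a).

Lemma RS_is_qsym (R : comNzRingType) (a : composition) :
  is_qsym (monomial_sum R [set T | RSCT a T] weight).
Proof.
apply: (@tableau_sum_is_qsym _ a) => [T []//|T g g0 gm].
exact: RSCT_relabel.
Qed.
Definition rs_qschur R a : qsym R := to_qsym (RS_is_qsym R a).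

Definition expo_of_multinom n (m : 'X_{1..n}) : expo :=
  [fsfun k in [fset k in iota 0 n]%fset => nth 0%N m k | 0%N].

Lemma edeg_multinom n (m : 'X_{1..n}) : edeg (expo_of_multinom m) = mdeg m.
Proof.
have E k : expo_of_multinom m k = nth 0%N m k.
  rewrite fsfunE !inE mem_iota add0n; case: ltnP => //= nk.
  by rewrite nth_default // size_tuple.
rewrite (@edegE _ (iota 0 n)) ?iota_uniq // => [|k]; last first.
  by rewrite E mem_iota; apply: contraR => nk; rewrite nth_default // size_tuple; lia.
rewrite mdegE -[n in iota 0 n]subn0 big_mkord.
by apply: eq_bigr => i _; rewrite E /fun_of_multinom (tnth_nth 0%N).
Qed.

Definition degree_bound (R : comNzRingType) (f : qsym R) : nat :=
  sval (cid (qsymP f).1).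

(* The polynomial f(x_1, ..., x_n); its coefficients are those of f, see
   mcoeff_qsym_poly below. *)
Definition qsym_poly (R : comNzRingType) (n : nat) (f : qsym R) : {mpoly R[n]} :=
  \sum_(m : 'X_{1..n < (degree_bound f).+1}) coef f (expo_of_multinom m) *: 'X_[m].

Lemma mcoeff_qsym_poly (R : comNzRingType) n (f : qsym R) m :
  (qsym_poly n f)@_m = coef f (expo_of_multinom m).
Proof.
rewrite /qsym_poly; have [le|gt] := leqP (mdeg m) (degree_bound f).
  by rewrite (mcoeff_mpoly (fun m => coef f (expo_of_multinom m))).
have := svalP (cid (qsymP f).1) (expo_of_multinom m).
rewrite edeg_multinom /coef => -> //; rewrite raddf_sum big1 //= => m' _.
rewrite mcoeffZ mcoeffX; case: eqP => [e|]; last by rewrite mulr0.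
by have := bmdeg m'; rewrite e ltnS leqNgt gt.
Qed.

Lemma finite_comp d : finite_set [set c : composition | (sumn c <= d)%N].
Proof.
pose f (p : 'I_d.+1 * {set 'I_d.+1}) :=
  set_comp p.1 (fun i => inord i \in p.2).
apply: (@sub_finite_set _ _ [set f p | p in [set: _]]); last first.
  by apply: finite_image; exact: finite_finset.
move=> c /= cd; exists (inord (sumn c), finset (fun k : 'I_d.+1 => (k : nat) \in comp_set c)) => //.
rewrite /f /= inordK ?ltnS // -[RHS]set_compK; apply: comp_set_inj.
  by rewrite !sumn_set_comp.
move=> i; rewrite !mem_comp_set /=; case: posnP => //= i0; case: ltnP => //= ic.
by rewrite finset.inE inordK //; lia.
Qed.

Lemma refines_sumn b a : refines b a -> sumn b = sumn a.
Proof. by case=> ss <- <-; rewrite sumn_flatten. Qed.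

Lemma finite_refines a : finite_set [set b | refines b a].
Proof.
apply: sub_finite_set (finite_comp (sumn a)) => b /= /refines_sumn ->.
exact: leqnn.
Qed.

Lemma refines_refl a : refines a a.
Proof.
exists [seq [:: x] | x <- a].
  by elim: (parts a) => //= x s ->.
by rewrite -map_comp -[RHS]map_id; apply: eq_map => x /=; rewrite addn0.
Qed.

Lemma refines_size b a : refines b a -> b != a -> (size a < size b)%N.
Proof.
case=> ss bE aE ba.
have [ss0 _] : all (fun r => 0 < size r)%N ss /\ True.
  split=> //; apply/allP => r rss; have := parts_gt0 a; rewrite -aE.
  by move/allP/(_ (sumn r)); rewrite map_f // => /(_ isT); case: (r).
have : (size ss < size (flatten ss))%N || (flatten ss == map sumn ss).
  elim: ss ss0 {bE aE} => [|[|x [|y r]] ss IH] //= /IH H.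
    by rewrite addn0 eqseq_cons eqxx /= ltnS.
  apply/orP; left; rewrite size_cat ltnS.
  have : (size ss <= size (flatten ss))%N.
    by case/orP: H => [/ltnW //|/eqP->]; rewrite size_map.
  lia.
case/orP; first by rewrite -bE -aE size_map.
by move=> /eqP E; case/eqP: ba; apply: val_inj; rewrite /= -bE -aE.
Qed.

Lemma coef_sum (R : comNzRingType) (I : Type) (r : seq I) (g : I -> qsym R) e :
  coef (\sum_(i <- r) g i) e = \sum_(i <- r) coef (g i) e.
Proof. by apply: (big_morph (fun f => coef f e)). Qed.

Lemma coef_F (R : comNzRingType) (a b : composition) t :
  sorted ltn t -> size t = size b ->
  coef (fundamental_qsym R a) (xpow t b) = `[< refines b a >]%:R.
Proof.
move=> st tb; rewrite /fundamental_qsym fsbig_finite; last exact: finite_refines.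
rewrite coef_sum; under eq_bigr do rewrite /coef /= monomial_seriesE //.
have [ab|nab] := asboolP.
  rewrite (bigD1_seq b) ?fset_uniq //=; last first.
    by rewrite in_fset_set ?inE //; exact: finite_refines.
  by rewrite eqxx big1 ?addr0 // => i /negPf ->.
rewrite big1_seq // => c /=; rewrite in_fset_set; last exact: finite_refines.
by rewrite inE /= => ca; case: eqP ca => // ->.
Qed.

Lemma qsym_ext (R : comNzRingType) (f g : qsym R) :
  (forall a : composition,
     coef f (xpow (iota 0 (size a)) a) = coef g (xpow (iota 0 (size a)) a)) ->
  f = g.
Proof.
move=> H; apply: val_inj; apply/funext => e /=.
pose s := sort leq (finsupp e).
have ss : sorted ltn s.
  by rewrite ltn_sorted_uniq_leq sort_uniq fset_uniq sort_sorted //; exact: leq_total.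
have a0 : all (leq 1) (map e s).
  rewrite all_map; apply/allP => k; rewrite mem_sort mem_finsupp /=.
  by rewrite lt0n.
pose a := Composition a0.
have eE : e = xpow s a.
  apply/fsfunP => k; rewrite xpowE ?size_map //=.
  have [ks|ks] := boolP (k \in s).
    by rewrite (nth_map 0%N) ?index_mem // nth_index.
  rewrite nth_default ?memNindex ?size_map //; apply/eqP.
  by move: ks; rewrite mem_sort mem_finsupp negbK.
have io : sorted ltn (iota 0 (size a)) by exact: iota_ltn_sorted.
have := H a; rewrite /coef.
have [_ fs] := qsymP f; have [_ gs] := qsymP g.
by rewrite eE (fs a s _ ss io) ?(gs a s _ ss io) ?size_iota ?size_map.
Qed.

Lemma qsym_M (R : comNzRingType) (f : qsym R) d :
  (forall e, (d < edeg e)%N -> coef f e = 0) ->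
  f = \sum_(a <- fset_set [set c : composition | (sumn c <= d)%N])
         coef f (xpow (iota 0 (size a)) a) *: monomial_qsym R a.
Proof.
move=> fd; apply: qsym_ext => b; set e := xpow _ b.
rewrite coef_sum.
have E (a : composition) : coef (coef f (xpow (iota 0 (size a)) a) *: monomial_qsym R a) e
   = coef f (xpow (iota 0 (size a)) a) * (a == b)%:R.
  rewrite -(@monomial_seriesE R a b (iota 0 (size b))) ?size_iota //.
  exact: iota_ltn_sorted.
under eq_bigr do rewrite E.
have [bd|bd] := leqP (sumn b) d.
  rewrite (bigD1_seq b) ?fset_uniq //=; last first.
    by rewrite in_fset_set ?inE //; exact: finite_comp.
  by rewrite eqxx mulr1 big1 ?addr0 // => a /negPf->; rewrite mulr0.
rewrite fd ?edeg_xpow ?iota_uniq ?size_iota // big1_seq // => a /=.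
rewrite in_fset_set; last exact: finite_comp.
by rewrite inE /= => ad; case: eqP ad => [->|]; [lia|rewrite mulr0].
Qed.

(* A linear map on Qsym is determined by its values on the F_a. *)
Lemma qsym_linear_ext (R : comNzRingType) (V : lmodType R)
    (u v : {linear qsym R -> V}) :
  (forall a, u (fundamental_qsym R a) = v (fundamental_qsym R a)) -> u =1 v.
Proof.
move=> uv.
have uvM n : forall a : composition, (sumn a - size a < n)%N ->
    u (monomial_qsym R a) = v (monomial_qsym R a).
  elim: n => // n IH a an.
  have := uv a; rewrite /fundamental_qsym fsbig_finite; last exact: finite_refines.
  rewrite !raddf_sum /= (bigD1_seq a) ?fset_uniq //=; last first.
    by rewrite in_fset_set ?inE; [exact: refines_refl|exact: finite_refines].
  rewrite [RHS](bigD1_seq a) ?fset_uniq //=; last first.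
    by rewrite in_fset_set ?inE; [exact: refines_refl|exact: finite_refines].
  have -> : \sum_(b <- fset_set [set b | refines b a] | b != a) u (monomial_qsym R b) =
    \sum_(b <- fset_set [set b | refines b a] | b != a) v (monomial_qsym R b); last first.
    by move/addIr.
  rewrite big_seq_cond [RHS]big_seq_cond; apply: eq_bigr => b /andP[].
  rewrite in_fset_set; last exact: finite_refines.
  rewrite inE /= => ba bna; apply: IH.
  have := refines_size ba bna; have := refines_sumn ba.
  have : (size b <= sumn b)%N.
    elim: (parts b) (parts_gt0 b) => //= x s IHs /andP[x0 /IHs]; lia.
  lia.
move=> f; have [[d fd] _] := qsymP f.
rewrite (@qsym_M R f d fd) !linear_sum; apply: eq_bigr => a _.
by rewrite !linearZ (uvM (sumn a - size a).+1).
Qed.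

(* Coordinates in the basis (F_a), by Moebius inversion over the coarsenings of
   x :: s. *)
Fixpoint F_coord_rec (R : comNzRingType) (x : nat) (s : seq nat)
    (g : seq nat -> R) : R :=
  if s is y :: s' then F_coord_rec y s' (fun c => g (x :: c))
                       - F_coord_rec (x + y)%N s' g
  else g [:: x].

Definition F_coord (R : comNzRingType) (a : composition) (f : qsym R) : R :=
  let g c := coef f (xpow (iota 0 (size c)) c) in
  if parts a is x :: s then F_coord_rec x s g else g [::].

Lemma F_coord_rec_eq (R : comNzRingType) x s (g h : seq nat -> R) :
  (0 < x)%N -> all (leq 1) s ->
  (forall c, all (leq 1) c -> sumn c = (x + sumn s)%N -> g c = h c) ->
  F_coord_rec x s g = F_coord_rec x s h.
Proof.
elim: s x g h => [|y s IH] x g h x0 /=.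
  by move=> _; apply => //=; rewrite x0.
move=> /andP[y0 s0] gh; congr (_ - _).
  by apply: IH => // c c0 cs; apply: gh => /=; rewrite ?x0 // cs.
by apply: IH => //; [lia|move=> c c0 cs; apply: gh => //; lia].
Qed.

Lemma F_coord_rec_linear (R : comNzRingType) x s k (g h : seq nat -> R) :
  F_coord_rec x s (fun c => k * g c + h c) =
  k * F_coord_rec x s g + F_coord_rec x s h.
Proof.
elim: s x g h => [|y s IH] x g h //=; rewrite !IH mulrBr opprD !addrA.
by congr (_ + _); rewrite addrAC.
Qed.

Lemma F_coord_linear (R : comNzRingType) (a : composition) k (f g : qsym R) :
  F_coord a (k *: f + g) = k * F_coord a f + F_coord a g.
Proof. by rewrite /F_coord; case: (parts a) => [|x s] //; rewrite -F_coord_rec_linear. Qed.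

Lemma F_coord0 (R : comNzRingType) (a : composition) (f : qsym R) d :
  (forall e, (d < edeg e)%N -> coef f e = 0) -> (d < sumn a)%N ->
  F_coord a f = 0.
Proof.
move=> fd; rewrite /F_coord; case: (parts a) (parts_gt0 a) => [|x s] //=.
move=> /andP[x0 s0] da; rewrite (F_coord_rec_eq (h := fun=> 0)) //.
  by elim: s x {x0 s0 da} => //= y s IH x; rewrite !IH subrr.
move=> c c0 cs; rewrite fd //.
by rewrite (@edeg_xpow _ (Composition c0)) ?iota_uniq ?size_iota //= cs.
Qed.

Definition refines_seq (c b : seq nat) : Prop :=
  exists2 ss : seq (seq nat), flatten ss = c & map sumn ss = b.

Lemma refines_seq_nil b : all (leq 1) b -> `[< refines_seq [::] b >] = (b == [::]).
Proof.
move=> b0; apply/asboolP/eqP => [[[|r ss] /= cE bE]|->]; last by exists [::].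
  by [].
move: b0; rewrite -bE; case: r cE bE => //= _ <-; by [].
Qed.

Lemma refines_seq_cons x c z b : (0 < x)%N -> (0 < z)%N -> all (leq 1) c ->
  `[< refines_seq (x :: c) (z :: b) >] =
  (x == z) && `[< refines_seq c b >] ||
  (x < z)%N && `[< refines_seq c ((z - x)%N :: b) >].
Proof.
move=> x0 z0 c0; apply/asboolP/idP => [[[|[|x' r] ss] //=]|].
- by move=> _ [zE _]; move: z0; rewrite -zE.
- move=> [-> cE] [<- bE]; case: r cE => [|y r] cE.
    rewrite addn0 eqxx /=; apply/orP; left; apply/asboolP.
    by exists ss.
  have y0 : (0 < y)%N by move: c0; rewrite -cE /= => /andP[].
  apply/orP; right; apply/andP; split; first by rewrite /=; lia.
  by apply/asboolP; exists ((y :: r) :: ss); rewrite //= bE addKn.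
- case/orP => /andP[].
    move=> /eqP <- /asboolP[ss <- <-].
    by exists ([:: x] :: ss) => //=; rewrite addn0.
  move=> xz /asboolP[[|r ss] //= cE [rE bE]].
  by exists ((x :: r) :: ss) => /=; rewrite ?cE // rE bE subnKC // ltnW.
Qed.

Lemma F_coord_rec_refines (R : comNzRingType) x s b :
  (0 < x)%N -> all (leq 1) s -> all (leq 1) b ->
  F_coord_rec x s (fun c => `[< refines_seq c b >]%:R : R) = (x :: s == b)%:R.
Proof.
have nnil z t : (0 < z)%N -> `[< refines_seq (z :: t) [::] >] = false.
  by move=> _; apply/asboolP => -[[]].
have subgt z : ~~ (x < z)%N -> (z - x = 0)%N by lia.
elim: s x b {subgt} => [|y s IH] x [|z b] x0 /=.
- by move=> _ _; rewrite nnil.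
- move=> _ /andP[z0 b0]; rewrite refines_seq_cons // refines_seq_nil //.
  case: ltnP => /= xz; last by rewrite orbF eqseq_cons [_ == b]eq_sym.
  rewrite refines_seq_nil /=; last by rewrite b0 andbT; lia.
  by rewrite orbF eqseq_cons [_ == b]eq_sym.
- move=> /andP[y0 s0] _; rewrite IH ?addn_gt0 ?x0 // subr0.
  rewrite (F_coord_rec_eq (h := fun c => `[< refines_seq c [::] >]%:R)) //.
    by rewrite IH.
  by move=> [|w c] c0 cs; rewrite !nnil //; [move: cs => /=; lia|case/andP: c0].
- move=> /andP[y0 s0] /andP[z0 b0]; rewrite IH ?addn_gt0 ?x0 //= ?z0 //.
  have [xz|xz|xz] := ltngtP x z.
  + rewrite (F_coord_rec_eq
      (h := fun c => `[< refines_seq c ((z - x)%N :: b) >]%:R)) //.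
      rewrite IH //=; last by rewrite b0 andbT; lia.
      rewrite !eqseq_cons.
      have -> : (x == z) = false by lia.
      have -> : (y == z - x)%N = (x + y == z)%N by lia.
      by rewrite subrr.
    move=> c c0 _; rewrite refines_seq_cons // xz.
    by have -> : (x == z) = false by lia.
  + rewrite (F_coord_rec_eq (h := fun c => (false)%:R)) //.
      rewrite eqseq_cons; have -> : (x + y == z)%N = false by lia.
      have -> : (x :: y :: s == z :: b) = false.
        by rewrite eqseq_cons (_ : (x == z) = false) //; lia.
      rewrite subr0; elim: s y {IH y0 s0} => //= w s IH y.
      by rewrite !IH subrr.
    move=> c c0 _; rewrite refines_seq_cons //.
    have -> : (x == z) = false by lia.
    by have -> : (x < z)%N = false by lia.
  + rewrite (F_coord_rec_eq (h := fun c => `[< refines_seq c b >]%:R)) //.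
      rewrite IH // !eqseq_cons xz eqxx.
      have -> : (z + y == z)%N = false by lia.
      by rewrite subr0.
    by move=> c c0 _; rewrite refines_seq_cons // xz eqxx ltnn orbF.
Qed.

Lemma F_coordF (R : comNzRingType) (a b : composition) :
  F_coord a (fundamental_qsym R b) = (a == b)%:R.
Proof.
rewrite -val_eqE /= /F_coord.
have cF c (c0 : all (leq 1) c) :
    coef (fundamental_qsym R b) (xpow (iota 0 (size c)) c) = `[< refines_seq c b >]%:R.
  rewrite (@coef_F R b (Composition c0)) ?size_iota //.
  exact: iota_ltn_sorted.
case: (parts a) (parts_gt0 a) => [|x s] /= => [_|/andP[x0 s0]].
  by rewrite (cF [::]) // refines_seq_nil ?parts_gt0 // eq_sym.
rewrite (F_coord_rec_eq (h := fun c => `[< refines_seq c b >]%:R)) //.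
  by rewrite F_coord_rec_refines // parts_gt0.
by move=> c c0 _; rewrite cF.
Qed.

Definition omega_fun (R : comNzRingType) (f : qsym R) : qsym R :=
  \sum_(a <- fset_set [set c : composition | (sumn c <= degree_bound f)%N])
    F_coord a f *: fundamental_qsym R (rev_comp (compl_comp a)).

Lemma omega_funE (R : comNzRingType) (f : qsym R) d :
  (degree_bound f <= d)%N ->
  omega_fun f =
  \sum_(a <- fset_set [set c : composition | (sumn c <= d)%N])
    F_coord a f *: fundamental_qsym R (rev_comp (compl_comp a)).
Proof.
move=> fd; rewrite /omega_fun.
rewrite [LHS]fsbig_seq ?fset_uniq // [RHS]fsbig_seq ?fset_uniq //.
rewrite !fset_setK; do ?exact: finite_comp.
apply: fsbig_widen => [a /= /leq_trans|a [/= _ /negP]]; first exact.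
rewrite -ltnNge => da; rewrite /preimage /=.
rewrite (F_coord0 _ da) ?scale0r // => e.
exact: (svalP (cid (qsymP f).1)).
Qed.

Lemma omega_fun_linear (R : comNzRingType) : linear (@omega_fun R).
Proof.
move=> k f g; pose d := (degree_bound f + degree_bound g + degree_bound (k *: f + g)%R)%N.
rewrite !(@omega_funE _ _ d); [|rewrite /d; lia..].
rewrite scaler_sumr -big_split /=; apply: eq_bigr => a _.
by rewrite F_coord_linear scalerDl scalerA.
Qed.

Lemma omega_exists (R : comNzRingType) :
  exists w : {linear qsym R -> qsym R},
    forall a, w (fundamental_qsym R a) = fundamental_qsym R (rev_comp (compl_comp a)).
Proof.
pose L := GRing.isLinear.Build R (qsym R) (qsym R) _ (@omega_fun R)
            (@omega_fun_linear R).
pose w : {linear qsym R -> qsym R} := HB.pack (@omega_fun R) L.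
exists w => a; rewrite /= (@omega_funE _ _ (degree_bound (fundamental_qsym R a) + sumn a)) ?leq_addr //.
rewrite (bigD1_seq a) ?fset_uniq //=; last first.
  by rewrite in_fset_set ?inE /=; [exact: leq_addl|exact: finite_comp].
rewrite F_coordF eqxx scale1r big1 ?addr0 // => b /negPf ba.
by rewrite F_coordF ba scale0r.
Qed.

(* The linear map sending each fundamental_qsym R a to
   fundamental_qsym R (rev_comp (compl_comp a)); see omegaF and omega_unique. *)
Definition omega (R : comNzRingType) : {linear qsym R -> qsym R} :=
  sval (cid (omega_exists R)).

Lemma omegaF (R : comNzRingType) a :
  omega R (fundamental_qsym R a) = fundamental_qsym R (rev_comp (compl_comp a)).
Proof. exact: svalP (cid (omega_exists R)) a. Qed.

Lemma omega_unique (R : comNzRingType) (w : {linear qsym R -> qsym R}) :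
  (forall a, w (fundamental_qsym R a) = fundamental_qsym R (rev_comp (compl_comp a))) -> w =1 omega R.
Proof. by move=> wF; apply: qsym_linear_ext => a; rewrite wF omegaF. Qed.

(* Main.v *)
Require Import Defs.
From mathcomp Require Import all_boot all_order all_algebra finmap.
From mathcomp Require Import boolp classical_sets cardinality fsbigop.
From mathcomp Require Import mpoly.
From mathcomp Require Import zify.

Set Implicit Arguments.
Unset Strict Implicit.
Unset Printing Implicit Defensive.

Import GRing.Theory.
Local Open Scope classical_set_scope.

(** Both families expand in the fundamental basis over the same index set, and
the two expansions are exchanged by complementing descent sets.

A filling of the diagram of a with distinct entries 1, ..., N satisfies the
column-strict axioms if and only if it satisfies the row-strict ones, since
weak and strict inequalities between entries of distinct cells agree; such a
filling is called standard. Grouping the tableaux by their standardization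
gives
<<
  S_a  = sum over standard T of F_(D T),
  RS_a = sum over standard T of F_(D' T),
>>
where D T is the set of labels p such that p+1 lies weakly to the right of p,
and D' T is the complement of D T ([qschur_fundamental],
[rs_qschur_fundamental]). As omega sends F_c to F_(rev of the complement of c),
omega S_a is the sum of the F_(rev (D' T)) ([omega_qschur]), and reversing a
composition amounts to reversing the variables of its fundamental function
([coef_fundamental_rev]).

Standardization is where the work lies. Fix a composition b of N. A standard T
yields a filling of content b by replacing each label by the number of the
block of b that contains it ([destandardize]). In the column-strict case equal
entries lie in distinct columns, and standardization numbers them from right to
left. In the row-strict case it numbers them from left to right, but a column
may contain equal entries: these are numbered from top to bottom in the first
column and from bottom to top in the others, the only choice that yields a
standard tableau. In both cases T is recovered from the filling, and the
fillings so obtained are the tableaux of content b, when the descents of T are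
among the partial sums of b, which is the condition for F_(D T) to have
coefficient 1 at the monomial of exponents b ([tableau_sum_coef]). The two
cases share all the arguments except the verification of the tableau axioms
([CSCT_standardizable], [RSCT_standardizable]). *)

(** * Cells of a diagram *)

Definition cells (a : seq nat) : seq (nat * nat) :=
  [seq (i, k) | i <- iota 0 (size a), k <- iota 0 (nth 0 a i)].

Lemma mem_cells a i k : ((i, k) \in cells a) = (k < nth 0 a i).
Proof.
apply/allpairsPdep/idP => [[i' [k' [_ + [-> ->]]]]|ki].
  by rewrite mem_iota.
exists i, k; rewrite !mem_iota !add0n; split=> //.
by rewrite ltnNge; apply: contraL ki => ai; rewrite (nth_default _ ai).
Qed.

Lemma mem_cells_row a i k : (i, k) \in cells a -> i < size a.
Proof. by case/allpairsPdep=> i' [k' [+ _ [-> _]]]; rewrite mem_iota. Qed.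

Lemma mem_cells_left a i k : (i, k.+1) \in cells a -> (i, k) \in cells a.
Proof. by rewrite !mem_cells; exact: ltnW. Qed.

Lemma mem_cells_col0 (a : composition) i :
  ((i, 0) \in cells a) = (i < size a).
Proof.
apply/idP/idP => [/mem_cells_row //|ia]; rewrite mem_cells.
exact: (all_nthP 0 (parts_gt0 a)).
Qed.

Lemma uniq_cells a : uniq (cells a).
Proof.
apply: allpairs_uniq_dep => [|i _|[i k] [i' k'] _ _ /= [-> ->] //];
  exact: iota_uniq.
Qed.

Lemma size_cells a : size (cells a) = sumn a.
Proof.
rewrite size_allpairs_dep -[in RHS](mkseq_nth 0 a); congr sumn.
by apply: eq_map => i; rewrite size_iota.
Qed.

Definition tableau_of (a : seq nat) (f : nat * nat -> nat) : seq (seq nat) :=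
  [seq [seq f (i, k) | k <- iota 0 (nth 0 a i)] | i <- iota 0 (size a)].

Lemma shape_tableau_of a f : map size (tableau_of a f) = a.
Proof.
rewrite -map_comp -[RHS](mkseq_nth 0); apply: eq_map => i /=.
by rewrite size_map size_iota.
Qed.

Lemma flatten_tableau_of a f : flatten (tableau_of a f) = map f (cells a).
Proof.
rewrite map_flatten -map_comp; congr flatten; apply: eq_map => i /=.
by rewrite -map_comp.
Qed.

Lemma entry_tableau_of a f c : c \in cells a ->
  entry (tableau_of a f) c.1 c.2 = f c.
Proof.
case: c => i k ca; have ia := mem_cells_row ca; rewrite mem_cells in ca.
rewrite /entry (nth_map 0) ?size_iota // (nth_map 0) ?size_iota ?nth_iota //.
Qed.

Lemma tableau_of_entry a T : map size T = a ->
  tableau_of a (fun c => entry T c.1 c.2) = T.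
Proof.
move=> <-; rewrite -[RHS](mkseq_nth [::]) /tableau_of size_map.
apply/eq_in_map => i; rewrite mem_iota => /= iT.
by rewrite (nth_map [::]) // -[RHS](mkseq_nth 0).
Qed.

Lemma flatten_cells a T : map size T = a ->
  flatten T = [seq entry T c.1 c.2 | c <- cells a].
Proof. by move=> /tableau_of_entry {1}<-; rewrite flatten_tableau_of. Qed.

Lemma eq_tableau a T T' : map size T = a -> map size T' = a ->
  {in cells a, forall c, entry T c.1 c.2 = entry T' c.1 c.2} -> T = T'.
Proof.
move=> /tableau_of_entry TE /tableau_of_entry TE' TT'; rewrite -TE -TE'.
apply/eq_map => i; apply/eq_in_map => k; rewrite mem_iota => ka.
by rewrite TT' // mem_cells.
Qed.

Lemma entry_notin a T i k : map size T = a -> (i, k) \notin cells a ->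
  entry T i k = 0.
Proof.
move=> <-; rewrite mem_cells -leqNgt /entry => ik; apply: nth_default.
have [iT|iT] := ltnP i (size T); last by rewrite nth_default.
by rewrite (nth_map [::]) in ik.
Qed.

Lemma filling_entry_gt0 a T i k : filling a T ->
  ((i, k) \in cells a) = (0 < entry T i k).
Proof.
move=> fT; have [ca|ca] := boolP (_ \in _); last first.
  by rewrite (entry_notin fT.1 ca).
apply/esym/(filling_gt0 fT); rewrite (flatten_cells fT.1).
by apply/mapP; exists (i, k).
Qed.

Lemma leq_largest_part (a : composition) i k :
  (i, k) \in cells a -> k < largest_part a.
Proof.
move=> ca; have ia := mem_cells_row ca; rewrite mem_cells in ca.
apply: leq_trans ca _.
by rewrite /largest_part (big_rem _ (mem_nth 0 ia)) /= leq_maxl.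
Qed.

(** * Composition tableaux, cell by cell *)

(** The tableau axioms for both families: (r1, r2) is (<=, <) in the
column-strict case, (<, <=) in the row-strict case, and (<, <) for standard
fillings, where the two coincide. *)
Definition composition_tableau (a : composition) (r1 r2 : rel nat)
    (T : seq (seq nat)) : Prop :=
  [/\ filling a T,
      forall i k, (i, k.+1) \in cells a -> r1 (entry T i k.+1) (entry T i k),
      forall i j, i < j < size a -> r2 (entry T i 0) (entry T j 0) &
      forall i j k, i < j -> (j, k.+1) \in cells a ->
        r1 (entry T i k.+1) (entry T j k.+1) ->
        r2 (entry T i k) (entry T j k.+1)].

Lemma rows_sortedP a T (r : rel nat) : map size T = a ->
  all (sorted r) T <->
  forall i k, (i, k.+1) \in cells a -> r (entry T i k) (entry T i k.+1).
Proof.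
move=> <-; split=> [/(all_nthP [::]) H i k ca|H].
  have := mem_cells_row ca; rewrite size_map => iT.
  rewrite mem_cells (nth_map [::]) // in ca.
  by have /(sortedP 0) := H i iT; apply.
apply/(all_nthP [::]) => i iT; apply/(sortedP 0) => k ki.
by apply: H; rewrite mem_cells (nth_map [::]).
Qed.

Lemma col_sortedP T n (r : rel nat) : transitive r ->
  sorted r [seq entry T i 0 | i <- iota 0 n] <->
  forall i j, i < j < n -> r (entry T i 0) (entry T j 0).
Proof.
move=> rtr; split=> [H i j /andP[ij jn]|H].
  have /(_ i j) := sorted_ltn_nth rtr 0 H; rewrite !inE size_map size_iota.
  have ltin := ltn_trans ij jn.
  by rewrite !(nth_map 0) ?size_iota ?nth_iota // => ->.
apply/(sortedP 0) => i; rewrite size_map size_iota => i1n.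
have ltin := ltnW i1n.
by rewrite !(nth_map 0) ?size_iota ?nth_iota // H // ltnSn.
Qed.

Lemma CSCT_composition_tableau (a : composition) T :
  CSCT a T <-> composition_tableau a leq ltn T.
Proof.
split=> -[fT row col trip].
  split=> //; first exact/(rows_sortedP geq fT.1).
    by apply/col_sortedP => //; exact: ltn_trans.
  move=> i j k ij ca; apply: trip; rewrite ?ij ?(mem_cells_row ca) //.
    exact: leq_largest_part ca.
  by rewrite -lt0n -(filling_entry_gt0 _ _ fT).
split=> //; first exact/(rows_sortedP geq fT.1).
  by apply/col_sortedP => //; exact: ltn_trans.
move=> i j k /andP[ij _] _; rewrite -lt0n -(filling_entry_gt0 _ _ fT).
exact: trip.
Qed.

Lemma RSCT_composition_tableau (a : composition) T :
  RSCT a T <-> composition_tableau a ltn leq T.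
Proof.
split=> -[fT row col trip].
  split=> //; first exact/(rows_sortedP gtn fT.1).
    by apply/col_sortedP => //; exact: leq_trans.
  move=> i j k ij ca; apply: trip; rewrite ?ij ?(mem_cells_row ca) //.
  exact: leq_largest_part ca.
split=> //; first exact/(rows_sortedP gtn fT.1).
  by apply/col_sortedP => //; exact: leq_trans.
move=> i j k /andP[ij _] _ lt_ij; apply: trip => //.
by rewrite (filling_entry_gt0 _ _ fT) (leq_ltn_trans _ lt_ij).
Qed.

(** * The blocks of a composition *)

(** The weakly increasing word 1...12...2... of content b. *)
Definition blocks (b : seq nat) : seq nat :=
  flatten [seq nseq (nth 0 b i) i.+1 | i <- iota 0 (size b)].

Lemma shape_blocks b :
  shape [seq nseq (nth 0 b i) i.+1 | i <- iota 0 (size b)] = b.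
Proof.
rewrite /shape -map_comp -[RHS](mkseq_nth 0); apply: eq_map => i /=.
exact: size_nseq.
Qed.

Lemma size_blocks b : size (blocks b) = sumn b.
Proof. by rewrite size_flatten shape_blocks. Qed.

Lemma nth_blocks b p : p < sumn b ->
  nth 0 (blocks b) p = (reshape_index b p).+1.
Proof.
move=> pb; rewrite nth_flatten shape_blocks.
have rb := reshape_indexP pb; have := reshape_offsetP pb.
by rewrite (nth_map 0) ?size_iota // nth_iota // nth_nseq => ->.
Qed.

Lemma sorted_blocks b : sorted leq (blocks b).
Proof.
apply/(sortedP 0) => p; rewrite size_blocks => pb.
rewrite !nth_blocks // ?(ltnW pb) // ltnS.
have := leqnSn p; rewrite (reshape_leq b p) => /orP[/ltnW //|/andP[/eqP-> _]].
exact: leqnn.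
Qed.

Lemma count_blocks b k : count_mem k.+1 (blocks b) = nth 0 b k.
Proof.
rewrite count_flatten -map_comp.
rewrite (eq_map (g := fun i => (i == k) * nth 0 b i)); last first.
  by move=> i /=; rewrite count_nseq /= eqSS.
rewrite sumnE big_map; have [kb|bk] := ltnP k (size b).
  rewrite (bigD1_seq k) ?mem_iota ?iota_uniq //= eqxx mul1n big1 ?addn0 //.
  by move=> i /negPf ->.
rewrite nth_default // big1_seq // => i /=; rewrite mem_iota => ib.
by case: eqP => // ik; rewrite -ik in bk; rewrite add0n ltnNge bk in ib.
Qed.

Lemma mem_comp_setP (b : composition) p :
  reflect ((0 < p < sumn b) /\ exists j, p = sumn (take j b))
    (p \in comp_set b).
Proof.
apply: (iffP idP) => [pb|[/andP[p0 pb] [j pE]]].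
  split; last by case/mapP: pb => j _ ->; exists j.
  have : p \in comp_set (set_comp (sumn b) (mem (comp_set b))).
    by rewrite set_compK.
  by rewrite mem_comp_set => /and3P[-> ->].
apply/mapP; exists j => //; rewrite mem_iota.
case: j pE => [|j] pE; first by rewrite pE take0 in p0.
have [jb|jb] := leqP (size b) j.+1.
  by rewrite pE take_oversize ?ltnn in pb.
by lia.
Qed.

(** Turns the condition that a descent is a partial sum of b into the condition
that the values increase strictly there. *)
Lemma nth_blocks_step (b : composition) p : 0 < p < sumn b ->
  nth 0 (blocks b) p = nth 0 (blocks b) p.-1 + (p \in comp_set b).
Proof.
case: p => // p /= pb; rewrite !nth_blocks ?(ltnW pb) // addSn; congr _.+1.
have rb := reshape_indexP pb; have cb := reshape_offsetP pb.
have pE := reshape_indexK b p.+1; move: rb cb pE.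
move: (reshape_index _ _) (reshape_offset _ _) => r [|c] rb cb.
  rewrite /flatten_index addn0 => pE.
  have -> : p.+1 \in comp_set b by apply/mem_comp_setP; split=> //; exists r.
  (* Position p.+1 opens block r.+1, so position p closes block r. *)
  case: r pE rb {cb} => [|r] pE rb; first by rewrite take0 in pE.
  have br := all_nthP 0 (parts_gt0 b) _ (ltnW rb).
  rewrite (take_nth 0 (ltnW rb)) sumn_rcons in pE.
  have -> : p = flatten_index b r (nth 0 b r).-1 by rewrite /flatten_index; lia.
  by rewrite flatten_indexKl ?addn1 //; lia.
rewrite /flatten_index => pE.
have -> : reshape_index b p = r.
  have -> : p = flatten_index b r c by rewrite /flatten_index; lia.
  by rewrite flatten_indexKl // ltnW.
case: mem_comp_setP => [[_ [j jE]]|]; last by rewrite addn0.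
have jb : j < size b.
  rewrite ltnNge; apply: contraL pb => bj; rewrite jE take_oversize //.
  by rewrite ltnn.
have bj := all_nthP 0 (parts_gt0 b) _ jb.
have := flatten_indexKr bj; rewrite /flatten_index addn0 -jE -pE.
by rewrite (flatten_indexKr cb).
Qed.

Lemma weight_blocks (a b : composition) T : filling a T ->
  weight T = xpow (iota 0 (size b)) b <-> perm_eq (flatten T) (blocks b).
Proof.
move=> fT.
have xE k : xpow (iota 0 (size b)) b k = nth 0 b k.
  rewrite xpowE ?size_iota //; have [kb|bk] := ltnP k (size b).
    by rewrite -{1}[k](nth_iota 0 0 kb) index_uniq ?size_iota ?iota_uniq.
  by rewrite !nth_default // memNindex ?size_iota // mem_iota add0n -leqNgt.
have nz s : 0 \notin s -> count_mem 0 s = 0 by move=> /count_memPn.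
have T0 : 0 \notin flatten T.
  by apply/negP => /(filling_gt0 fT).
have b0 : 0 \notin blocks b.
  by apply/flattenP => -[_ /mapP[i _ ->]]; rewrite mem_nseq andbF.
split=> [wT|/permP H].
  apply/allP => x _ /=; apply/eqP; case: x => [|k]; first by rewrite !nz.
  by rewrite count_blocks -xE -wT (weightE _ fT.2).
by apply/fsfunP => k; rewrite (weightE _ fT.2) H count_blocks xE.
Qed.

Lemma sumn_take_leq (b : seq nat) i j :
  i <= j -> sumn (take i b) <= sumn (take j b).
Proof.
move=> ij; rewrite -(cat_take_drop i (take j b)) sumn_cat.
by rewrite take_takel // leq_addr.
Qed.

Lemma refines_seqP (b a : seq nat) : all (leq 1) b ->
  refines_seq b a <->
  sumn b = sumn a /\ forall i, exists j, sumn (take i a) = sumn (take j b).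
Proof.
move=> b0; split=> [[ss <- <-]|].
  rewrite sumn_flatten; split=> // i; exists (size (flatten (take i ss))).
  rewrite -map_take -sumn_flatten; congr sumn.
  rewrite -[in X in _ = take _ X](cat_take_drop i ss) flatten_cat.
  by rewrite take_size_cat.
elim: a b b0 => [|x a IH] b b0 [bE H].
  have -> : b = [::] by case: b b0 bE {H} => //= y b /andP[y0 _] yb; lia.
  by exists [::].
have [j jE] := H 1; rewrite /= take0 /= addn0 in jE.
have [||ss ssE aE] := IH (drop j b).
- by move: b0; rewrite -{1}(cat_take_drop j b) all_cat => /andP[].
- split=> [|i].
    by move: bE; rewrite -{1}(cat_take_drop j b) sumn_cat -jE /= => /addnI.
  have [j' /= j'E] := H i.+1; exists (j' - j).
  have [jj'|jj'] := leqP j j'.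
    rewrite take_drop subnK //; apply: (@addnI x); rewrite j'E {1}jE.
    by rewrite -(take_takel b jj') -sumn_cat cat_take_drop.
  rewrite (eqP (ltnW jj' : _ - _ == _)) take0 /=.
  by have := sumn_take_leq b (ltnW jj'); lia.
by exists (take j b :: ss); rewrite /= ?ssE ?cat_take_drop // -jE aE.
Qed.

(** Via [coef_F], the coefficient of a fundamental function at a packed
monomial is read off the descent set alone. *)
Lemma refines_set_comp (b : composition) N (D : pred nat) :
  refines b (set_comp N D) <->
  sumn b = N /\ forall p, 0 < p < N -> D p -> p \in comp_set b.
Proof.
apply: iff_trans (refines_seqP (set_comp N D) (parts_gt0 b)) _.
rewrite sumn_set_comp.
split=> -[bN H]; split=> //; [move=> p /andP[p0 pN] Dp|move=> i].
  have : p \in comp_set (set_comp N D) by rewrite mem_comp_set p0 pN.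
  move=> /mem_comp_setP[_ [i pE]]; have [j jE] := H i; apply/mem_comp_setP.
  by rewrite bN p0 pN; split=> //; exists j; rewrite pE.
set p := sumn _; have [pN|Np] := ltnP p N; last first.
  have pE : p = N.
    apply/eqP; rewrite eqn_leq Np andbT -[X in _ <= X](sumn_set_comp N D).
    by rewrite -[X in _ <= sumn X](cat_take_drop i) sumn_cat leq_addr.
  by exists (size b); rewrite take_size pE.
have [p0|p0] := posnP p; first by exists 0; rewrite take0 p0.
have : p \in comp_set (set_comp N D).
  apply/mem_comp_setP; rewrite sumn_set_comp p0 pN; split=> //.
  by exists i.
rewrite mem_comp_set => /and3P[_ _ Dp].
suff /mem_comp_setP[] : p \in comp_set b by [].
by apply: H; rewrite ?p0.
Qed.

(** * Standard tableaux and their labels *)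

Definition at_cell (T : seq (seq nat)) (c : nat * nat) : nat := entry T c.1 c.2.

Definition cell_of (a : seq nat) (T : seq (seq nat)) (p : nat) : nat * nat :=
  nth (0, 0) (cells a) (index p (flatten T)).

Definition standard (a : composition) (T : seq (seq nat)) : Prop :=
  composition_tableau a ltn ltn T /\ perm_eq (flatten T) (iota 1 (sumn a)).

Section Labels.
Variables (a : seq nat) (T : seq (seq nat)).
Hypotheses (sT : map size T = a) (pT : perm_eq (flatten T) (iota 1 (sumn a))).

Lemma flatten_at_cell : flatten T = map (at_cell T) (cells a).
Proof. exact: flatten_cells. Qed.

Lemma at_cell_bounds c : c \in cells a -> 0 < at_cell T c <= sumn a.
Proof.
move=> ca; have : at_cell T c \in flatten T by rewrite flatten_at_cell map_f.
by rewrite (perm_mem pT) mem_iota add1n ltnS.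
Qed.

Lemma cell_ofK : {in cells a, cancel (at_cell T) (cell_of a T)}.
Proof.
move=> c ca; have uT : uniq (flatten T) by rewrite (perm_uniq pT) iota_uniq.
rewrite /cell_of -{2}(nth_index (0, 0) ca); congr nth.
have ic : index c (cells a) < size (flatten T).
  by rewrite flatten_at_cell size_map index_mem.
rewrite -(index_uniq 0 ic uT) flatten_at_cell (nth_map (0, 0)) ?index_mem //.
by rewrite nth_index.
Qed.

Lemma at_cell_inj : {in cells a &, injective (at_cell T)}.
Proof. exact: can_in_inj cell_ofK. Qed.

Lemma mem_cell_of p : 0 < p <= sumn a -> cell_of a T p \in cells a.
Proof.
move=> pa; rewrite mem_nth // -(size_map (at_cell T)) -flatten_at_cell.
by rewrite index_mem (perm_mem pT) mem_iota add1n ltnS.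
Qed.

Lemma at_cell_of p : 0 < p <= sumn a -> at_cell T (cell_of a T p) = p.
Proof.
move=> pa; have pfT : p \in flatten T.
  by rewrite (perm_mem pT) mem_iota add1n ltnS.
rewrite -[RHS](nth_index 0 pfT) {1}flatten_at_cell (nth_map (0, 0)) //.
by rewrite -(size_map (at_cell T)) -flatten_at_cell index_mem.
Qed.

(** Labels are ranks, so that a labelling by 1, ..., N is determined by the
order that it puts on the cells. *)
Lemma at_cell_rank c : c \in cells a ->
  at_cell T c = (count (fun d => at_cell T d < at_cell T c) (cells a)).+1.
Proof.
move=> ca; have := at_cell_bounds ca; move: (at_cell T c) => p /andP[p0 pN].
rewrite -[count _ _](count_map (at_cell T) (ltn^~ p)) -flatten_at_cell.
rewrite (permP pT) -[sumn a](@subnKC p.-1) ?(leq_trans (leq_pred p)) //.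
rewrite iotaD count_cat (_ : count _ (iota 1 _) = p.-1); last first.
  rewrite -[RHS](size_iota 1); apply/eqP; rewrite -all_count; apply/allP => x.
  by rewrite mem_iota /=; lia.
rewrite (_ : count _ _ = 0) ?addn0 ?prednK //.
apply/eqP; rewrite -leqn0 leqNgt -has_count -all_predC; apply/allP => x.
by rewrite mem_iota /=; lia.
Qed.

End Labels.

(** * Standardization *)

(** The labels of T list the cells by increasing value of F, and equal values
in an order that e allows. *)
Definition refines_values (a : seq nat) (e : rel (nat * nat))
    (T F : seq (seq nat)) : Prop :=
  {in cells a &, forall c d, at_cell T c < at_cell T d ->
     (at_cell F c < at_cell F d) || (at_cell F c == at_cell F d) && e c d}.

(** Standardization is unique: two labellings that resolve the ties of F by the
same total preorder order the cells in the same way. *)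
Lemma refines_values_inj a (tie : rel (nat * nat)) T T' F : total tie ->
  map size T = a -> perm_eq (flatten T) (iota 1 (sumn a)) ->
  map size T' = a -> perm_eq (flatten T') (iota 1 (sumn a)) ->
  refines_values a (fun c d => ~~ tie d c) T F ->
  refines_values a (fun c d => ~~ tie d c) T' F ->
  T = T'.
Proof.
move=> tot sT pT sT' pT' TF T'F.
have half U U' : map size U' = a -> perm_eq (flatten U') (iota 1 (sumn a)) ->
    refines_values a (fun c d => ~~ tie d c) U F ->
    refines_values a (fun c d => ~~ tie d c) U' F ->
    {in cells a &, forall c d, at_cell U c < at_cell U d ->
       at_cell U' c < at_cell U' d}.
  move=> sU' pU' UF U'F c d ca da cd; have Fcd := UF c d ca da cd.
  rewrite ltnNge leq_eqVlt negb_or; apply/andP; split.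
    by apply: contraTneq cd => /(at_cell_inj sU' pU' da ca) ->; rewrite ltnn.
  apply/negP => /(U'F d c da ca); move: Fcd.
  have [//|//|_] := ltngtP (at_cell F c) (at_cell F d).
  by rewrite /= => /negPf dc; have := tot c d; rewrite dc orbF => ->.
apply: (eq_tableau sT sT') => c ca.
rewrite -![entry _ c.1 c.2]/(at_cell _ c) (at_cell_rank sT pT ca).
rewrite (at_cell_rank sT' pT' ca); congr _.+1.
apply: eq_in_count => d da; apply/idP/idP.
  exact: (half T T').
exact: (half T' T).
Qed.

(** The prepended 0 makes the block of the label p.+1 the p-th letter, and keeps
the value 0 outside the diagram. *)
Definition destandardize (b : seq nat) : seq (seq nat) -> seq (seq nat) :=
  map (map (nth 0 (0 :: blocks b))).

Lemma map_iota1 (s : seq nat) : map (nth 0 (0 :: s)) (iota 1 (size s)) = s.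
Proof.
by rewrite (iotaDl 1 0) -map_comp -[RHS](mkseq_nth 0); apply: eq_map.
Qed.

Lemma at_cell_destandardize b T c :
  at_cell (destandardize b T) c = nth 0 (0 :: blocks b) (at_cell T c).
Proof. exact: entry_map. Qed.

Lemma perm_destandardize b T :
  perm_eq (flatten T) (iota 1 (sumn b)) ->
  perm_eq (flatten (destandardize b T)) (blocks b).
Proof.
move=> /(perm_map (nth 0 (0 :: blocks b))).
by rewrite -map_flatten -size_blocks map_iota1.
Qed.

Lemma filling_destandardize (a b : composition) T : map size T = a ->
  sumn b = sumn a -> perm_eq (flatten T) (iota 1 (sumn a)) ->
  filling a (destandardize b T).
Proof.
move=> sT ba; rewrite -ba => pT; split.
  by rewrite -map_comp -sT; apply: eq_map => r; rewrite /= size_map.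
apply/allP => r rT; apply/allP => x xr.
have : x \in flatten (destandardize b T) by apply/flattenP; exists r.
rewrite (perm_mem (perm_destandardize pT)) => /flattenP[s].
by case/mapP => i _ ->; rewrite mem_nseq => /andP[_ /eqP ->].
Qed.

Lemma lex_total (F : nat * nat -> nat) (tie : rel (nat * nat)) :
  total tie -> total (fun c d => (F c < F d) || (F c == F d) && tie c d).
Proof.
by move=> tot c d; have [] := ltngtP (F c) (F d); rewrite ?orbT ?tot.
Qed.

Lemma lex_trans (F : nat * nat -> nat) (tie : rel (nat * nat)) :
  transitive tie ->
  transitive (fun c d => (F c < F d) || (F c == F d) && tie c d).
Proof.
move=> tr d c f.
case/orP=> [cd|/andP[/eqP-> cd]]; case/orP=> [df|/andP[/eqP<- df]].
- by rewrite (ltn_trans cd df).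
- by rewrite cd.
- by rewrite df.
- by rewrite ltnn eqxx (tr _ _ _ cd df).
Qed.

(** Existence: the cells sorted by value, ties being resolved by a total
preorder, are labelled by their positions. The values then form the word of
blocks, whence F is recovered. *)
Lemma standardization (a b : seq nat) (tie : rel (nat * nat)) F :
  total tie -> transitive tie -> map size F = a ->
  perm_eq (flatten F) (blocks b) ->
  {in cells a &, forall c d, at_cell F c = at_cell F d -> tie c d -> tie d c ->
     c = d} ->
  exists T, [/\ map size T = a, perm_eq (flatten T) (iota 1 (sumn a)),
    refines_values a (fun c d => ~~ tie d c) T F & F = destandardize b T].
Proof.
move=> tot tr sF pF anti.
pose le c d := (at_cell F c < at_cell F d)
               || (at_cell F c == at_cell F d) && tie c d.
pose s := sort le (cells a); have ps : perm_eq s (cells a) by rewrite perm_sort.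
have ss : sorted le s by apply: sort_sorted; exact: lex_total.
have le_tr : transitive le by exact: lex_trans.
have us : uniq s by rewrite (perm_uniq ps) uniq_cells.
have bE : blocks b = map (at_cell F) s.
  apply: (sorted_eq leq_trans anti_leq); rewrite ?sorted_blocks //.
    rewrite sorted_map; apply: sub_sorted ss => c d /= /orP[/ltnW //|].
    by case/andP => /eqP ->.
  rewrite -(permPl pF) (flatten_at_cell sF); apply: perm_map.
  by rewrite perm_sym.
pose f c := (index c s).+1; pose T := tableau_of a f.
have Tf c : c \in cells a -> at_cell T c = f c by exact: entry_tableau_of.
have sT : map size T = a by exact: shape_tableau_of.
have mems c : (c \in s) = (c \in cells a) by exact: perm_mem.
exists T; split=> //.
- rewrite /T flatten_tableau_of -(permPl (perm_map f ps)).
  have -> : map f s = iota 1 (size s).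
    rewrite (iotaDl 1 0) -[in LHS](mkseq_nth (0, 0) s) -map_comp.
    apply/eq_in_map => i; rewrite mem_iota add0n /= => i_s.
    by rewrite /f index_uniq.
  by rewrite (perm_size ps) size_cells.
- move=> c d ca da; rewrite !Tf // ltnS => cd.
  have := sorted_ltn_index le_tr ss c d; rewrite !mems => /(_ ca da cd).
  rewrite /le; case: ltngtP => //= Fcd tcd; apply/negP => tdc.
  by rewrite (anti c d ca da Fcd tcd tdc) ltnn in cd.
- apply: (eq_tableau sF) => [|c ca].
    by rewrite -map_comp -sT; apply: eq_map => r; rewrite /= size_map.
  rewrite -![entry _ c.1 c.2]/(at_cell _ c) at_cell_destandardize Tf //= bE.
  by rewrite (nth_map (0, 0)) ?index_mem ?nth_index ?mems.
Qed.

(** Inside a block of b the labels are consecutive, so that, e being transitive,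
it suffices to compare each label with the next one: this fails exactly at
the descents, which must therefore separate two blocks. *)
Lemma refines_destandardize (a b : composition) (e : rel (nat * nat)) T :
  transitive e -> sumn b = sumn a -> map size T = a ->
  perm_eq (flatten T) (iota 1 (sumn a)) ->
  refines_values a e T (destandardize b T) <->
  forall p, 0 < p < sumn a -> ~~ e (cell_of a T p) (cell_of a T p.+1) ->
    p \in comp_set b.
Proof.
move=> tr ba sT pT; pose v := nth 0 (0 :: blocks b).
have vS p : 0 < p < sumn a -> v p.+1 = v p + (p \in comp_set b).
  by rewrite -ba => pb; rewrite /v /= nth_blocks_step //; case: p pb.
split=> [TF p /andP[p0 pa] ne|H c d ca da cd].
  have pa1 : 0 < p <= sumn a by rewrite p0 ltnW.
  have := TF (cell_of a T p) (cell_of a T p.+1).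
  rewrite !at_cell_destandardize !mem_cell_of ?at_cell_of //.
  rewrite (negPf ne) andbF orbF.
  move=> /(_ isT isT (ltnSn p)); rewrite -/v vS ?p0 //.
  by case: (_ \in _); rewrite ?addn0 ?ltnn.
rewrite !at_cell_destandardize -/v.
rewrite -[X in e X _](cell_ofK sT pT ca) -[X in e _ X](cell_ofK sT pT da).
have /andP[p0 _] := at_cell_bounds sT pT ca.
have /andP[_ qa] := at_cell_bounds sT pT da.
move: (at_cell T c) (at_cell T d) p0 qa cd => p q {c d ca da} p0.
elim: q => // q IH qa; rewrite ltnS leq_eqVlt => /orP[/eqP pq|pq].
  rewrite -{}pq in IH qa *; rewrite vS ?p0 //.
  have [pb|pb] := boolP (p \in comp_set b); first by rewrite addn1 ltnSn.
  rewrite addn0 ltnn eqxx /=.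
  by apply: contraNT pb => ne; apply: H ne; rewrite p0.
have q0 := ltn_trans p0 pq.
have := IH (ltnW qa) pq; rewrite vS ?q0 //.
have [pb|pb] := boolP (q \in comp_set b).
  by rewrite addn1 ltnS; case/orP=> [/ltnW ->|/andP[/eqP-> _]]; rewrite ?leqnn.
rewrite addn0; case/orP=> [-> //|/andP[-> epq]]; apply/orP; right.
apply: tr epq _.
by apply: contraNT pb => ne; apply: H ne; rewrite q0.
Qed.

(** * The standardization rules of the two families *)

Definition descents (e : rel (nat * nat)) (a : seq nat) T : pred nat :=
  fun p => ~~ e (cell_of a T p) (cell_of a T p.+1).

(** What standardization requires of a family of tableaux. The preorder tie says
in which order equal entries are numbered, and serves to construct standard
tableaux. The descents are defined with e, a consequence of the strict part of
tie; on standard tableaux the tableau axioms make up for the difference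
([std_tie_refines]), so that both relations select the same tableaux. *)
Record standardizable (r1 r2 : rel nat) (e tie : rel (nat * nat)) : Prop := {
  std_trans : transitive e;
  std_tie_total : total tie;
  std_tie_trans : transitive tie;
  std_tie_sub : forall c d, ~~ tie d c -> e c d;
  std_tie_anti : forall (a : composition) F, composition_tableau a r1 r2 F ->
    {in cells a &, forall c d, at_cell F c = at_cell F d ->
      tie c d -> tie d c -> c = d};
  std_tie_refines : forall (a : composition) T F, standard a T ->
    refines_values a e T F ->
    refines_values a (fun c d => ~~ tie d c) T F;
  std_tableau : forall (a : composition) T F, standard a T -> filling a F ->
    refines_values a e T F -> composition_tableau a r1 r2 F;
  std_standard : forall (a : composition) T F, composition_tableau a r1 r2 F ->
    map size T = a -> perm_eq (flatten T) (iota 1 (sumn a)) ->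
    refines_values a (fun c d => ~~ tie d c) T F -> standard a T }.

Lemma filling_of_perm (a : composition) T : map size T = a ->
  perm_eq (flatten T) (iota 1 (sumn a)) -> filling a T.
Proof.
move=> sT pT; split=> //; apply/allP => r rT; apply/allP => x xr.
have : x \in flatten T by apply/flattenP; exists r.
by rewrite (perm_mem pT) mem_iota => /andP[].
Qed.

Lemma refines_values_le a e T F c d : refines_values a e T F ->
  c \in cells a -> d \in cells a -> at_cell T c < at_cell T d ->
  at_cell F c <= at_cell F d.
Proof.
by move=> TF ca da /(TF c d ca da)/orP[/ltnW //|/andP[/eqP-> _]].
Qed.

Lemma refines_values_lt a e T F c d : refines_values a e T F ->
  map size T = a -> perm_eq (flatten T) (iota 1 (sumn a)) ->
  c \in cells a -> d \in cells a -> c != d ->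
  (at_cell F c < at_cell F d) || (at_cell F c == at_cell F d) && ~~ e d c ->
  at_cell T c < at_cell T d.
Proof.
move=> TF sT pT ca da cd Fcd; case: ltngtP => // [/(TF d c da ca)|].
  by case: ltngtP Fcd => //= _ /negPf ->.
by move=> /(at_cell_inj sT pT ca da) cE; rewrite cE eqxx in cd.
Qed.

(** Equal entries of a column-strict tableau lie in distinct columns, and the
one further to the right receives the smaller label: within a row it has to,
as the labels decrease there. *)
Lemma CSCT_standardizable :
  standardizable leq ltn (fun c d => d.2 < c.2) (fun c d => d.2 <= c.2).
Proof.
split.
- by move=> d c f /= dc fd; exact: ltn_trans fd dc.
- by move=> c d; exact: leq_total.
- by move=> d c f /= dc fd; exact: leq_trans fd dc.
- by move=> c d; rewrite -ltnNge.
- move=> a F [fF row col trip] [i k] [j k'] ca da /= Fcd ki kj.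
  rewrite /= in row col trip.
  have ? : k' = k by lia.
  (* The first column is strictly increasing; in the others the triple axiom
     excludes equal entries. *)
  subst k'; have noeq i' j' : i' < j' -> (j', k) \in cells a ->
    at_cell F (i', k) <> at_cell F (j', k).
    rewrite /at_cell /= => ij jka; case: k {ki kj ca da Fcd} jka => [|k] jka.
      have /col : i' < j' < size a by rewrite ij (mem_cells_row jka).
      by move=> /[swap] ->; rewrite ltnn.
    move=> Fij; have lt_ij := trip i' j' k ij jka.
    rewrite Fij leqnn in lt_ij; have {}lt_ij := lt_ij isT.
    have [ika|ika] := boolP ((i', k.+1) \in cells a).
      by have := row i' k ika; rewrite Fij leqNgt lt_ij.
    have := filling_entry_gt0 j' k.+1 fF; rewrite jka -Fij.
    by rewrite (entry_notin fF.1 ika).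
  have [ij|ij|-> //] := ltngtP i j; first by case: (noeq i j ij da Fcd).
  by case: (noeq j i ij ca (esym Fcd)).
- by move=> a T F _ TF c d ca da /(TF c d ca da); rewrite /= -ltnNge.
- move=> a T F [[fT row col trip] pT] fF TF.
  rewrite /= in row col trip; split=> //=.
  + move=> i k ca; have ca' := mem_cells_left ca.
    exact: (refines_values_le TF ca ca' (row i k ca)).
  + move=> i j ij; have /andP[ltij ja] := ij; have ia := ltn_trans ltij ja.
    rewrite -!mem_cells_col0 in ia ja.
    by have := TF _ _ ia ja (col i j ij); rewrite andbF orbF.
  + move=> i j k ij ja Fij.
    have [ia|ia] := boolP ((i, k) \in cells a); last first.
      by rewrite (entry_notin fF.1 ia) -(filling_entry_gt0 _ _ fF).
    have Tij : entry T i k.+1 < entry T j k.+1.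
      have [ia'|ia'] := boolP ((i, k.+1) \in cells a); last first.
        by rewrite (entry_notin fT.1 ia') -(filling_entry_gt0 _ _ fT).
      apply: (refines_values_lt TF fT.1 pT ia' ja).
        by rewrite xpair_eqE ltn_eqF.
      by rewrite /= ltnn andbT orbC -leq_eqVlt.
    have := TF (i, k) (j, k.+1) ia ja (trip i j k ij ja Tij).
    by rewrite /= [k.+1 < k]ltnNge leqnSn andbF orbF.
- move=> a T F [fF row col trip] sT pT TF.
  rewrite /= in row col trip; have fT := filling_of_perm sT pT.
  split=> //; split=> //=.
  + move=> i k ca; have ca' := mem_cells_left ca.
    apply: (refines_values_lt TF sT pT ca ca') => /=.
      by rewrite xpair_eqE eqxx /= gtn_eqF.
    by rewrite leqnSn andbT orbC -leq_eqVlt; exact: row.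
  + move=> i j ij; have /andP[ltij ja] := ij; have ia := ltn_trans ltij ja.
    rewrite -!mem_cells_col0 in ia ja.
    apply: (refines_values_lt TF sT pT ia ja) => /=.
      by rewrite xpair_eqE eqxx andbT ltn_eqF.
    by apply/orP; left; exact: col.
  + move=> i j k ij ja Tij.
    have [ia|ia] := boolP ((i, k) \in cells a); last first.
      by rewrite (entry_notin sT ia) (leq_ltn_trans _ Tij).
    apply: (refines_values_lt TF sT pT ia ja) => /=.
      by rewrite xpair_eqE ltn_eqF.
    apply/orP; left; apply: trip => //.
    have [ia'|ia'] := boolP ((i, k.+1) \in cells a); last first.
      by rewrite (entry_notin fF.1 ia').
    exact: (refines_values_le TF ia' ja Tij).
Qed.

(** Columns from left to right; inside a column from top to bottom for the
first one, where labels must increase, and from bottom to top for the others,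
by the triple axiom. *)
Definition rs_tie (c d : nat * nat) : bool :=
  (c.2 < d.2) || (c.2 == d.2) && (if c.2 == 0 then c.1 <= d.1 else d.1 <= c.1).

(** The order inside a column is forced: let (i, k.+1) and (j, k.+1), with
i < j, be cells with equal entries whose labels increase downwards. By the
triple axiom the label of (i, k) lies between these two labels, so its entry
equals theirs; but equal entries are labelled from left to right, and (i, k)
has a larger label than (i, k.+1). *)
Lemma RSCT_standardizable :
  standardizable ltn leq (fun c d => c.2 <= d.2) rs_tie.
Proof.
split.
- by move=> d c f /=; exact: leq_trans.
- move=> [i k] [j k']; rewrite /rs_tie /=; case: (ltngtP k k') => //= ->.
  by case: (k' == 0); exact: leq_total.
- move=> [i k] [j k'] [l m]; rewrite /rs_tie /=.
  have [|] := eqVneq k' 0; have [|] := eqVneq k 0; lia.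
- by move=> [i k] [j k']; rewrite /rs_tie /=; lia.
- move=> a F _ [i k] [j k'] _ _ _; rewrite /rs_tie /=.
  move=> cd dc; congr (_, _); move: cd dc;
    have [|] := eqVneq k' 0; have [|] := eqVneq k 0; lia.
- move=> a T F [[fT row col trip] pT] TF [i k] [j k'] ca da Tcd.
  rewrite /= in row col trip.
  case/orP: (TF _ _ ca da Tcd) => [-> //|/= /andP[/eqP Fcd kk']].
  rewrite Fcd eqxx ltnn /=; have [kk|kk] := ltnP k k'.
    by rewrite /rs_tie /=; lia.
  have ? : k' = k by lia.
  subst k'; rewrite /rs_tie /= ltnn eqxx /= {kk kk'}.
  have ij : i != j by apply: contraTneq Tcd => ->; rewrite ltnn.
  case: k ca da Tcd Fcd => [|k] ca da Tcd Fcd /=; rewrite -ltnNge.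
    rewrite ltn_neqAle ij /= leqNgt; apply/negP => ji.
    have := col j i; rewrite ji (mem_cells_row ca) => /(_ isT).
    by rewrite ltnNge (ltnW Tcd).
  rewrite ltn_neqAle eq_sym ij /= leqNgt; apply/negP => ltij.
  (* The label of (i, k) lies between those of (i, k.+1) and (j, k.+1). *)
  have Tkj := trip i j k ltij da Tcd.
  have ca' := mem_cells_left ca; have Tki := row i k ca.
  have Fkj := refines_values_le TF ca' da Tkj.
  have /orP[Fki|] := TF _ _ ca ca' Tki; last by rewrite /= ltnNge leqnn andbF.
  by rewrite Fcd ltnNge Fkj in Fki.
- move=> a T F [[fT row col trip] pT] fF TF.
  rewrite /= in row col trip; split=> //=.
  + move=> i k ca; have ca' := mem_cells_left ca.
    by have := TF _ _ ca ca' (row i k ca); rewrite /= ltnn andbF orbF.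
  + move=> i j ij; have /andP[ltij ja] := ij; have ia := ltn_trans ltij ja.
    rewrite -!mem_cells_col0 in ia ja.
    exact: (refines_values_le TF ia ja (col i j ij)).
  + move=> i j k ij ja Fij.
    have [ia|ia] := boolP ((i, k) \in cells a); last first.
      by rewrite (entry_notin fF.1 ia).
    apply: (refines_values_le TF ia ja); apply: trip => //.
    have [ia'|ia'] := boolP ((i, k.+1) \in cells a); last first.
      by rewrite (entry_notin fT.1 ia') -(filling_entry_gt0 _ _ fT).
    apply: (refines_values_lt TF fT.1 pT ia' ja).
      by rewrite xpair_eqE ltn_eqF.
    by rewrite [X in X || _]Fij.
- move=> a T F [fF row col trip] sT pT TF.
  rewrite /= in row col trip; have fT := filling_of_perm sT pT.
  split=> //; split=> //=.
  + move=> i k ca; have ca' := mem_cells_left ca.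
    apply: (refines_values_lt TF sT pT ca ca') => /=.
      by rewrite xpair_eqE eqxx /= gtn_eqF.
    by apply/orP; left; exact: row.
  + move=> i j ij; have /andP[ltij ja] := ij; have ia := ltn_trans ltij ja.
    rewrite -!mem_cells_col0 in ia ja.
    apply: (refines_values_lt TF sT pT ia ja) => /=.
      by rewrite xpair_eqE eqxx andbT ltn_eqF.
    by rewrite negbK /rs_tie /= (ltnW ltij) andbT orbC -leq_eqVlt; exact: col.
  + move=> i j k ij ja Tij.
    have [ia|ia] := boolP ((i, k) \in cells a); last first.
      by rewrite (entry_notin sT ia) (leq_ltn_trans _ Tij).
    apply: (refines_values_lt TF sT pT ia ja) => /=.
      by rewrite xpair_eqE ltn_eqF.
    rewrite /rs_tie /= ltnSn negbK andbT orbC -leq_eqVlt; apply: trip => //.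
    have [ia'|ia'] := boolP ((i, k.+1) \in cells a); last first.
      by rewrite (entry_notin fF.1 ia') -(filling_entry_gt0 _ _ fF).
    have /orP[//|] := TF _ _ ia' ja Tij.
    by rewrite /rs_tie /= ltnn eqxx (ltnW ij) andbF.
Qed.

(** * Expansions in the fundamental basis *)

(** Standard tableaux all have the weight of the single row 1, ..., N. *)
Lemma finite_standard (a : composition) : finite_set [set T | standard a T].
Proof.
apply: sub_finite_set (finite_filling a (weight [:: iota 1 (sumn a)])).
move=> T [[fT _ _ _] /permP pT]; split=> //; apply/fsfunP => k.
rewrite (weightE _ fT.2) weightE /= ?cats0 ?pT // andbT.
by apply/allP => x; rewrite mem_iota => /andP[].
Qed.

(** The coefficient at b counts the tableaux of content b; these correspond
bijectively, by standardization, to the standard tableaux whose descents are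
partial sums of b. *)
Lemma tableau_sum_coef (R : comNzRingType) r1 r2 e tie (a b : composition) :
  standardizable r1 r2 e tie ->
  monomial_sum R [set F | composition_tableau a r1 r2 F] weight
    (xpow (iota 0 (size b)) b) =
  (\sum_(T \in [set T | standard a T])
     (`[< refines b (set_comp (sumn a) (descents e a T)) >]%:R : R))%R.
Proof.
move=> std; have [ba|ba] := eqVneq (sumn b) (sumn a); last first.
  rewrite /monomial_sum !fsbig1 // => [T _|F [fF _ _ _]].
    by case: asboolP => // /refines_set_comp[]/eqP; rewrite (negPf ba).
  case: eqP => // /(congr1 edeg); rewrite (edeg_weight fF).
  rewrite edeg_xpow ?iota_uniq ?size_iota //.
  by move/eqP; rewrite eq_sym (negPf ba).
rewrite monomial_sum_fibre.
pose Q := [set T | refines b (set_comp (sumn a) (descents e a T))].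
transitivity (\sum_(T \in [set T | standard a T] `&` Q) (1 : R))%R; last first.
  rewrite fsbig_mkcondr; apply: eq_fsbigr => T _.
  by case: ifPn; rewrite (inE, notin_setE) /Q /= => H; case: asboolP.
have QP T : standard a T ->
    Q T <-> refines_values a e T (destandardize b T).
  move=> [[fT _ _ _] pT].
  rewrite (refines_destandardize (std_trans std) ba fT.1 pT).
  rewrite /Q /= refines_set_comp; split=> [[_]|]; last by split.
  exact.
have nt T : standard a T -> map size T = a by case=> -[[]].
apply: (reindex_fsbig (destandardize b)); split.
- move=> T [sT /(QP T sT) TF]; have [_ pT] := sT.
  have fF := filling_destandardize (nt T sT) ba pT; split.
    exact: (std_tableau std) sT fF TF.
  by apply/(weight_blocks b fF); apply: perm_destandardize; rewrite ba.
- move=> T T' /set_mem[sT /(QP T sT) TF] /set_mem[sT' /(QP T' sT') TF'] E.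
  have sTF := std_tie_refines std sT TF.
  have sTF' := std_tie_refines std sT' TF'.
  rewrite -E in sTF'.
  exact: (refines_values_inj (std_tie_total std) (nt _ sT) sT.2
    (nt _ sT') sT'.2 sTF sTF').
- move=> F [ctF wF]; have [fF _ _ _] := ctF.
  have pF := (weight_blocks b fF).1 wF.
  have [T [shT pT TF FE]] := standardization (std_tie_total std)
    (std_tie_trans std) fF.1 pF (std_tie_anti std ctF).
  have sT := std_standard std ctF shT pT TF.
  exists T; last exact: esym.
  split=> //; apply/(QP T sT); rewrite -FE => c d ca da /(TF c d ca da).
  by case/orP=> [-> //|/andP[-> /(std_tie_sub std) ->]]; rewrite orbT.
Qed.

Lemma tableau_sum_fundamental (R : comNzRingType) r1 r2 e tie (a : composition)
    (f : qsym R) :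
  standardizable r1 r2 e tie ->
  qsym_val f = monomial_sum R [set F | composition_tableau a r1 r2 F] weight ->
  f = (\sum_(T <- fset_set [set T | standard a T])
        fundamental_qsym R (set_comp (sumn a) (descents e a T)))%R.
Proof.
move=> std fE; apply: qsym_ext => b.
rewrite Defs.coef_sum /coef fE (tableau_sum_coef _ _ _ std).
rewrite fsbig_finite; last exact: finite_standard.
apply: eq_bigr => T _; rewrite -[RHS]/(coef _ _) coef_F ?size_iota //.
exact: iota_ltn_sorted.
Qed.

Lemma qschur_fundamental (R : comNzRingType) (a : composition) :
  qschur R a = (\sum_(T <- fset_set [set T | standard a T])
    fundamental_qsym R
      (set_comp (sumn a) (descents (fun c d => (d.2 < c.2)%N) a T)))%R.
Proof.
apply: (tableau_sum_fundamental CSCT_standardizable) => /=.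
congr monomial_sum; apply/seteqP.
by split=> T /=; rewrite CSCT_composition_tableau.
Qed.

Lemma rs_qschur_fundamental (R : comNzRingType) (a : composition) :
  rs_qschur R a = (\sum_(T <- fset_set [set T | standard a T])
    fundamental_qsym R
      (set_comp (sumn a) (descents (fun c d => (c.2 <= d.2)%N) a T)))%R.
Proof.
apply: (tableau_sum_fundamental RSCT_standardizable) => /=.
congr monomial_sum; apply/seteqP.
by split=> T /=; rewrite RSCT_composition_tableau.
Qed.

(** * The action of omega *)

Lemma compl_set_comp N (D : pred nat) :
  compl_comp (set_comp N D) = set_comp N (fun p => ~~ D p).
Proof.
apply: comp_set_inj; rewrite ?sumn_set_comp // => p.
rewrite !mem_comp_set sumn_set_comp.
by case: (0 < p); case: (p < N).
Qed.

(** The complement of the descent set of the column-strict reading is the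
descent set of the row-strict one. *)
Lemma omega_qschur (R : comNzRingType) (a : composition) :
  omega R (qschur R a) = (\sum_(T <- fset_set [set T | standard a T])
    fundamental_qsym R (rev_comp
      (set_comp (sumn a) (descents (fun c d => (c.2 <= d.2)%N) a T))))%R.
Proof.
rewrite qschur_fundamental linear_sum; apply: eq_bigr => T _.
rewrite omegaF compl_set_comp; congr (fundamental_qsym _ (rev_comp _)).
apply: comp_set_inj; rewrite ?sumn_set_comp // => p; rewrite !mem_comp_set.
by rewrite /descents negbK -ltnNge.
Qed.

(** * Reversing the variables *)

Lemma refines_rev (a b : composition) :
  refines b a -> refines (rev_comp b) (rev_comp a).
Proof.
move=> [ss bE aE]; exists (rev (map rev ss)) => /=.
  by rewrite -rev_flatten bE.
rewrite map_rev -map_comp -aE; congr rev; apply: eq_map => r /=.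
by rewrite sumn_rev.
Qed.

Lemma rev_compK : involutive rev_comp.
Proof. by move=> a; apply: val_inj; rewrite /= revK. Qed.

Definition rev_multinom n (m : 'X_{1..n}) : 'X_{1..n} :=
  [multinom m (rev_ord i) | i < n].

Lemma rev_multinomK n : involutive (@rev_multinom n).
Proof. by move=> m; apply/mnmP => i; rewrite !mnmE rev_ordK. Qed.

Lemma expo_of_multinomE n (m : 'X_{1..n}) k : expo_of_multinom m k = nth 0 m k.
Proof.
rewrite fsfunE !inE mem_iota add0n; case: ltnP => //= nk.
by rewrite nth_default // size_tuple.
Qed.

Lemma nth_rev_multinom n (m : 'X_{1..n}) k : k < n ->
  nth 0 (rev_multinom m) k = nth 0 m (n - k.+1).
Proof.
move=> kn; have -> : k = Ordinal kn by [].
rewrite -tnth_nth -[LHS]/(rev_multinom m (Ordinal kn)) mnmE.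
by rewrite /fun_of_multinom (tnth_nth 0).
Qed.

Lemma xpowP (e : expo) s (a : composition) : sorted ltn s -> size s = size a ->
  (forall i, i < size s -> e (nth 0 s i) = nth 0 a i) ->
  (forall k, k \notin s -> e k = 0) -> e = xpow s a.
Proof.
move=> ss sa eE e0; apply/fsfunP => k; rewrite xpowE //.
have [ks|ks] := boolP (k \in s).
  by rewrite -eE ?index_mem // nth_index.
by rewrite e0 // nth_default // memNindex ?sa.
Qed.

(** Every monomial is packed along its support, which reduces coefficients to
those given by [coef_F]. *)
Lemma expo_xpow (e : expo) : exists s (a : composition),
  [/\ sorted ltn s, size s = size a & e = xpow s a].
Proof.
pose s := sort leq (finsupp e).
have ss : sorted ltn s.
  rewrite ltn_sorted_uniq_leq sort_uniq fset_uniq /=.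
  exact: (sort_sorted leq_total).
have a0 : all (leq 1) (map e s).
  by rewrite all_map; apply/allP => k; rewrite mem_sort mem_finsupp /= lt0n.
exists s, (Composition a0); rewrite size_map; split=> //.
apply: xpowP; rewrite ?size_map //; first by move=> i si; rewrite (nth_map 0).
by move=> k; rewrite mem_sort memNfinsupp => /eqP.
Qed.

Lemma expo_rev_multinom n (m : 'X_{1..n}) s (a : composition) :
  sorted ltn s -> size s = size a -> expo_of_multinom m = xpow s a ->
  let t := rev [seq n - k.+1 | k <- s] in
  [/\ sorted ltn t, size t = size (rev_comp a)
    & expo_of_multinom (rev_multinom m) = xpow t (rev_comp a)].
Proof.
move=> ss sa mE t.
have s_n k : k \in s -> k < n.
  rewrite -(xpow_supp k sa) -mE expo_of_multinomE; apply: contraR.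
  by rewrite -leqNgt => nk; rewrite nth_default ?size_tuple.
have st : sorted ltn t.
  rewrite rev_sorted sorted_map; apply: (@sub_in_sorted _ (mem s)) ss;
    last exact/allP.
  by move=> k l /s_n kn /s_n ln /=; lia.
have sat : size t = size (rev_comp a) by rewrite !size_rev size_map.
split=> //; apply: xpowP => // [i it|k].
  have is_ : size s - i.+1 < size s by move: it; rewrite size_rev size_map; lia.
  have i_s : i < size s by move: it; rewrite size_rev size_map.
  have := s_n _ (mem_nth 0 is_); rewrite expo_of_multinomE.
  rewrite nth_rev ?size_map // (nth_map 0) // => kn.
  rewrite nth_rev_multinom ?subnSK // ?leq_subr // (subKn (ltnW kn)).
  rewrite -expo_of_multinomE mE xpow_nth ?sorted_ltn_uniq //.
  by rewrite /= nth_rev -sa.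
rewrite expo_of_multinomE; have [nk _|kn kt] := leqP n k.
  by rewrite nth_default ?size_tuple.
rewrite nth_rev_multinom // -expo_of_multinomE mE; apply/eqP.
rewrite -[_ == _]negbK (xpow_supp _ sa); apply: contra kt => ks.
by rewrite mem_rev; apply/mapP; exists (n - k.+1) => //; lia.
Qed.

Lemma mPo_rev (R : comNzRingType) n (p : {mpoly R[n]}) m :
  ((p \mPo [tuple 'X_(rev_ord i) | i < n])@_m = p@_(rev_multinom m))%R.
Proof.
rewrite comp_mpolyEX raddf_sum /=.
rewrite [in RHS](mpolyE p) raddf_sum /=; apply: eq_bigr => m' _.
rewrite !mcoeffZ mcoeffX; congr (_ * _)%R.
have -> : ('X_[m'] \mPo [tuple 'X_(rev_ord i) | i < n]
            = 'X_[R, rev_multinom m'])%R.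
  rewrite comp_mpolyX (mpolyXE_id R (rev_multinom m')).
  rewrite (reindex_inj rev_ord_inj); apply: eq_bigr => i _.
  by rewrite tnth_mktuple mnmE rev_ordK.
rewrite mcoeffX; congr (_%:R)%R; congr nat_of_bool.
by apply/eqP/eqP => [<-|->]; rewrite rev_multinomK.
Qed.

Lemma coef_fundamental_rev (R : comNzRingType) n (a : composition)
    (m : 'X_{1..n}) :
  coef (fundamental_qsym R (rev_comp a)) (expo_of_multinom m) =
  coef (fundamental_qsym R a) (expo_of_multinom (rev_multinom m)).
Proof.
have [s [b [ss sb mE]]] := expo_xpow (expo_of_multinom m).
have [st tb mrE] := expo_rev_multinom ss sb mE.
rewrite mE mrE !coef_F //; congr (_%:R)%R; congr nat_of_bool.
by apply/asboolP/asboolP => /refines_rev; rewrite ?rev_compK.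
Qed.

Local Open Scope ring_scope.

Theorem theorem5p1 (R : comNzRingType) (a : composition) (n : nat)
    (hn : (0 < n)%N) :
  qsym_poly n (omega R (qschur R a)) =
  qsym_poly n (rs_qschur R a) \mPo [tuple 'X_(rev_ord i) | i < n].
Proof.
apply/mpolyP => m; rewrite mPo_rev !mcoeff_qsym_poly.
rewrite omega_qschur rs_qschur_fundamental !Defs.coef_sum.
by apply: eq_bigr => T _; exact: coef_fundamental_rev.
Qed.
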